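(* Let the scales $\{E_s\}_{s>0}$, $\{G_s\}_{s>0}$, the constants $C,T,R>0$, $\phi,\alpha\ge 0$, the semigroup $S^t$ and the map $f$ be as described in the context. 1) (Classical setup.) Suppose in addition that $G_s=E_s$ and that $S^t=e^{At}$ is generated by a linear operator $A:E_{s+\delta}\to E_s$ in the sense that for any $u\in E_{s+\delta}$ $$\lim_{h\to 0+}\Big\|\frac1h\big(e^{Ah}-\mathrm{id}_{E_{s+\delta}}\big)u-Au\Big\|^E_s=0 .$$ Suppose that the problem $$u_t=f(t,u)+Au$$ is parabolic, i.e. the semigroup $S^t$ is parabolic (with constant $\gamma>1$) and $\chi=\phi+\alpha/\gamma<1$. Then there exists a constant $T_*>0$ such that this problem has a solution $$u(t)\in E^1(T_* )=\bigcap_{0<s^\gamma<\tau<T_*}C^1\big((\tau,T_* ),E_s\big),$$ and for any constant $c\in(0,1)$ one has $$\|u(t)\|^E_{ct^{1/\gamma}}\to 0\quad\text{as } t\searrow 0$$ (this is the sense in which the initial condition $u|_{t=0}=0$ holds). The function $u(t)$ also solves the integral equation $u(t)=\int_0^t S^{t-\xi}f(\xi,u(\xi))\,d\xi$. 2) (Generalized setup; the additional assumptions of part 1 are not made.) Suppose that the problem $$u(t)=\int_0^tS^{t-\xi}f(\xi,u(\xi))\,d\xi$$ is parabolic, i.e. the semigroup $S^t$ is parabolic (with constant $\gamma>1$) and $\chi=\phi+\alpha/\gamma<1$. Then there exists a constant $T_*>0$ such that this problem has a solution $$u(t)\in E(T_* )=\bigcap_{0<s^\gamma<\tau<T_*}C\big((\tau,T_*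 ),E_s\big).$$ In both cases the constant $T_*$ depends only on $C,\alpha,\gamma,\phi$.
   Context: Setting. $\{E_s,\|\cdot\|^E_s\}_{s>0}$ and $\{G_s,\|\cdot\|^G_s\}_{s>0}$ are two scales of Banach spaces such that $E_s\subseteq G_s$ for all $s>0$. All the embeddings $E_{s+\delta}\subseteq E_s$, $\delta>0$, are completely continuous (compact), and $\|\cdot\|^E_s\le\|\cdot\|^E_{s+\delta}$. Constants $C,T,R>0$ and $\phi,\alpha\ge 0$ are given. Semigroup. $S^t:G_s\to E_s$, $t>0$, is a linear semigroup that is strongly continuous in the following sense: for any $u\in E_s$, $\|S^tu-u\|^E_s\to 0$ as $t\searrow 0$, and $\|S^tu\|^E_s\le C\|u\|^E_s$. The semigroup $S^t$ is called parabolic if there exists a constant $\gamma>1$ such that for any $\delta,t>0$ with $\delta^\gamma<t<T$, $$\|S^tu\|^E_{s+\delta}\le \frac{C}{t^\phi}\|u\|^G_s .$$ Nonlinearity. $B_s(r)$ is the open ball of $E_s$ with radius $r$ and center at the origin, and $\overline B_s(r)$ is its closure. The function $f:(0,T]\times\overline B_{s+\delta}(R)\to G_s$ is continuous and such that if $(s+\delta)^\gamma<t\le T$ and $u\in\overline B_{s+\delta}(R)$ then $$\|f(t,u)\|^G_s\le\frac{C}{\delta^\alpha},$$ with $\gamma$ the constant from the definition of a parabolic semigroup. Function spaces. $E^1(T_* )$ consists of all functions $u$ that map any $t\in(0,T_* )$ to an element $u(t)\in\bigcap_{0<s^\gamma<t}E_s$ and such that the restriction $u|_{(\tau,T_* )}$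 belongs to $C^1((\tau,T_* ),E_s)$ for all $s\in(0,\tau^{1/\gamma})$, $\tau\in(0,T_* )$. The space $E(T_* )$ is understood in the same way with $C$ in place of $C^1$.
   Formalization: T_* may depend on the given constants T and R as well as on C, α, γ, φ; independence of T and R is false: for E_s=G_s=ℝ, S^t=id, A=0, f=1, C=1, α=φ=0 the only solution u(t)=t leaves the domain of f at t=min(T,R). *)

(* Defs.v *)
(* Stdlib reals with Coquelicot (vector-valued derivatives and integrals). *)
From Stdlib Require Import Reals.
From Coquelicot Require Import Coquelicot.

Set Implicit Arguments.
Unset Strict Implicit.
Unset Printing Implicit Defensive.

Open Scope R_scope.

(* A scale of real Banach spaces indexed by s > 0.  To make sense of set
   inclusions and of the same element lying in several spaces, each Banach space
   [E s] comes with an injective linear map into one vector space [V]; no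
   topology on [V] is used.  (Abstractly, V is the union of the spaces of the
   largest scale involved, which is a vector space because a scale is nested.)
   Nothing is required of [E s] for s <= 0. *)
Record scale (V : ModuleSpace R_Ring) := Scale {
  space :> R -> CompleteNormedModule R_AbsRing;
  emb : forall s : R, space s -> V;
  emb_plus : forall s, 0 < s -> forall x y : space s,
    emb (plus x y) = plus (emb x) (emb y);
  emb_scal : forall s, 0 < s -> forall (k : R) (x : space s),
    emb (scal k x) = scal k (emb x);
  emb_inj : forall s, 0 < s -> forall x y : space s, emb x = emb y -> x = y;
  emb_nested : forall s delta, 0 < s -> 0 < delta ->
    forall x : space (s + delta), exists y : space s, emb y = emb x
}.

Section Setting.
Variable V : ModuleSpace R_Ring.
Implicit Types (E G : scale V) (Sg : R -> V -> V) (f : R -> V -> V)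
  (A : V -> V) (u : R -> V).

Definition mem E (s : R) (v : V) : Prop := exists x : E s, emb x = v.

(* v belongs to E_s and its E_s-norm is at most r; this is also how norm
   estimates on elements of V are expressed. *)
Definition cball E (s r : R) (v : V) : Prop :=
  exists x : E s, emb x = v /\ norm x <= r.

(* The E_(s t)-norm of w t tends to 0 as t decreases to 0. *)
Definition norm_to_0 E (s : R -> R) (w : R -> V) : Prop :=
  forall eps : posreal, at_right 0 (fun t => cball E (s t) eps (w t)).

Definition scale_incl E G : Prop :=
  forall s, 0 < s -> forall v, mem E s v -> mem G s v.

Definition norm_monotone E : Prop :=
  forall s delta, 0 < s -> 0 < delta ->
  forall x : E (s + delta), cball E s (norm x) (emb x).

Definition compact_embeddings E : Prop :=
  forall s delta, 0 < s -> 0 < delta ->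
  forall (x : nat -> E (s + delta)) (M : R), (forall n, norm (x n) <= M) ->
  exists (k : nat -> nat) (y : nat -> E s) (l : E s),
    (forall n, (k n < k (S n))%nat) /\
    (forall n, emb (y n) = emb (x (k n))) /\
    filterlim y eventually (locally l).

Definition linear_on G (L : V -> V) : Prop :=
  forall s, 0 < s ->
    (forall x y : G s, L (plus (emb x) (emb y)) = plus (L (emb x)) (L (emb y))) /\
    (forall (k : R) (x : G s), L (scal k (emb x)) = scal k (L (emb x))).

(* [Sg t] is the operator S^t; only its values on the spaces G_s and for t > 0
   matter. *)
Definition strongly_continuous_semigroup (C : R) E G Sg : Prop :=
  (forall s t, 0 < s -> 0 < t -> forall x : G s, mem E s (Sg t (emb x))) /\
  (forall t, 0 < t -> linear_on G (Sg t)) /\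
  (forall s t r, 0 < s -> 0 < t -> 0 < r ->
     forall x : G s, Sg (t + r) (emb x) = Sg t (Sg r (emb x))) /\
  (forall s, 0 < s -> forall x : E s,
     norm_to_0 E (fun _ => s) (fun t => minus (Sg t (emb x)) (emb x))) /\
  (forall s t, 0 < s -> 0 < t -> forall x : E s,
     cball E s (C * norm x) (Sg t (emb x))).

Definition parabolic (C T phi gamma : R) E G Sg : Prop :=
  forall s delta t, 0 < s -> 0 < delta -> 0 < t ->
  Rpower delta gamma < t < T ->
  forall x : G s, cball E (s + delta) (C / Rpower t phi * norm x) (Sg t (emb x)).

(* f is a single map on the union of the sets (0,T] x closed ball of E_s; the
   function F below is f read as a map from E_(s+delta) to G_s, continuous for
   the norm topologies of these spaces. *)
Definition nonlinearity_continuous (T Rad : R) E G f : Prop :=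
  forall s delta, 0 < s -> 0 < delta ->
  let D (p : R * E (s + delta)) := 0 < fst p <= T /\ norm (snd p) <= Rad in
  exists F : R * E (s + delta) -> G s,
    (forall p, D p -> emb (F p) = f (fst p) (emb (snd p))) /\
    continuous_on D F.

Definition nonlinearity_bounded (C T Rad alpha gamma : R) E G f : Prop :=
  forall s delta t, 0 < s -> 0 < delta ->
  Rpower (s + delta) gamma < t <= T ->
  forall v, cball E (s + delta) Rad v ->
  cball G s (C / Rpower delta alpha) (f t v).

Definition generator E Sg A : Prop :=
  linear_on E A /\
  forall s delta, 0 < s -> 0 < delta -> forall x : E (s + delta),
    mem E s (A (emb x)) /\
    norm_to_0 E (fun _ => s) (fun h =>
      minus (scal (1 / h) (minus (Sg h (emb x)) (emb x))) (A (emb x))).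

Definition C0_on E (s a b : R) u : Prop :=
  exists w : R -> E s, forall t, a < t < b ->
    emb (w t) = u t /\ continuous w t.

Definition C1_on E (s a b : R) u : Prop :=
  exists w dw : R -> E s, forall t, a < t < b ->
    emb (w t) = u t /\ is_derive w t (dw t) /\ continuous dw t.

Definition in_all_spaces (gamma Tstar : R) E u : Prop :=
  forall t, 0 < t < Tstar ->
  forall s, 0 < s -> Rpower s gamma < t -> mem E s (u t).

(* The spaces E(Tstar) and E^1(Tstar). *)
Definition E0space (gamma Tstar : R) E u : Prop :=
  in_all_spaces gamma Tstar E u /\
  forall tau s, 0 < tau < Tstar -> 0 < s < Rpower tau (1 / gamma) ->
    C0_on E s tau Tstar u.

Definition E1space (gamma Tstar : R) E u : Prop :=
  in_all_spaces gamma Tstar E u /\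
  forall tau s, 0 < tau < Tstar -> 0 < s < Rpower tau (1 / gamma) ->
    C1_on E s tau Tstar u.

(* f(t,u(t)) is defined as an element of every G_s with s^gamma < t. *)
Definition in_domain (T Rad gamma Tstar : R) E u : Prop :=
  forall t, 0 < t < Tstar -> t <= T /\
  forall s, 0 < s -> Rpower s gamma < t -> cball E s Rad (u t).

Definition derivative_in E (s : R) u (t : R) (v : V) : Prop :=
  exists (w : R -> E s) (d : E s),
    locally t (fun r => emb (w r) = u r) /\ is_derive w t d /\ emb d = v.

(* v is the integral of g over (0,t) in E_s.  The integrands of interest may be
   unbounded at both ends, so this is an absolutely convergent improper
   Riemann integral. *)
Definition integral_in E (s : R) (g : R -> V) (t : R) (v : V) : Prop :=
  exists (w : R -> E s) (I : E s),
    (forall xi, 0 < xi < t -> emb (w xi) = g xi) /\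
    ex_RInt_gen (fun xi => norm (w xi)) (at_right 0) (at_left t) /\
    is_RInt_gen w (at_right 0) (at_left t) I /\
    emb I = v.

(* u_t = f(t,u) + A u on (0,Tstar), in each E_s with s^gamma < t. *)
Definition solves_ode (T Rad gamma Tstar : R) E f A u : Prop :=
  in_domain T Rad gamma Tstar E u /\
  forall t s, 0 < t < Tstar -> 0 < s -> Rpower s gamma < t ->
    derivative_in E s u t (plus (f t (u t)) (A (u t))).

Definition solves_integral (T Rad gamma Tstar : R) E Sg f u : Prop :=
  in_domain T Rad gamma Tstar E u /\
  forall t s, 0 < t < Tstar -> 0 < s -> Rpower s gamma < t ->
    integral_in E s (fun xi => Sg (t - xi) (f xi (u xi))) t (u t).

Definition zero_initial_condition (gamma : R) E u : Prop :=
  forall c, 0 < c < 1 -> norm_to_0 E (fun t => c * Rpower t (1 / gamma)) u.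

End Setting.

(* Main.v *)
(* The solution is a limit of Tonelli's delayed approximations
   u(t) = int_h^(t-h) S^(t-xi) f(xi,u(xi)) dxi.
   Since gamma > 1, xi^(1/gamma) + (t-xi)^(1/gamma) exceeds t^(1/gamma) by a multiple
   of min(xi,t-xi)^(1/gamma).  Spending this excess on the loss of regularity in f bounds
   the integrand, in the norm of index t^(1/gamma), by a multiple of
   xi^(-chi) + (t-xi)^(-chi), with no loss at the end index; hence the part of the
   integral over (a,b) is at most K (b-a)^(1-chi).  This gives the a priori bound that
   keeps u in the ball of radius Rad and fixes Tstar, and it bounds u(t') - S^(t'-t) u(t).
   On bounded sets of E_s', S^h tends to the identity in E_s, s < s', uniformly, because
   the embedding is compact; the approximations are therefore equicontinuous, and a
   diagonal subsequence converges to a solution of the integral equation.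
   In the classical setup, uniform boundedness of (S^h - 1)/h from E_s' to E_s makes A
   bounded between these spaces and yields the derivative of u from both sides. *)
Require Import Defs.
From Stdlib Require Import Reals ZArith Lra Lia Classical ClassicalEpsilon Cantor.
From Coquelicot Require Import Coquelicot.
Open Scope R_scope.

(** * Powers with exponent between 0 and 1 *)

(** Two obstacles shape the proof. The map f is merely continuous, so no contraction is available;
    and f(t, .) is controlled only on a ball, so each approximation must already obey the bounds
    wanted of the solution. The delayed equation answers both: finitely many substitutions solve it
    exactly, and its solutions satisfy two estimates that are independent of the delay and survive
    pointwise limits. The integrand is singular at both ends. Near xi = t the smoothing of S^(t-xi)
    costs (t-xi)^(-phi). Near either end little index is left over for f, and a loss delta costs
    delta^(-alpha). With m = min(xi,t-xi) and delta of order m^(1/gamma) the total is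
    m^(-phi-alpha/gamma), so chi < 1 is exactly integrability. Integrals over closed subintervals of
    (0,t) are estimated at index t^(1/gamma) itself, whereas u(t) is placed only in the spaces of
    smaller index: each use of compactness or of the generator costs a little index, and the strict
    inequality leaves room to pay it. Improper integrals are kept out of the limit arguments by
    comparing u(t) with integrals over [a,b] up to explicit errors. *)

Lemma Rpower_pos (x y : R) : 0 < Rpower x y.
Proof. apply exp_pos. Qed.

Lemma ln_le_sub_1 (x : R) : 0 < x -> ln x <= x - 1.
Proof.
intros Hx. generalize (exp_ineq1_le (ln x)). rewrite exp_ln by easy. lra.
Qed.

Lemma exp_le (x y : R) : x <= y -> exp x <= exp y.
Proof. intros [H | ->]; [left; now apply exp_increasing | right; easy]. Qed.

(** Concavity of the logarithm: 1 + p y is the mean of 1 + y and 1 with weights p and 1 - p. The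
    bound ln z <= z - 1, applied to both points divided by this mean, gives weighted right-hand
    sides that sum to zero. *)
Lemma Rpower_bernoulli (p y : R) : 0 <= p <= 1 -> 0 < y ->
  Rpower (1 + y) p <= 1 + p * y.
Proof.
intros Hp Hy.
assert (HA : 0 < 1 + p * y) by nra.
rewrite <- (exp_ln (1 + p * y)) by easy.
apply exp_le.
assert (H1 : ln ((1 + y) / (1 + p * y)) <= (1 + y) / (1 + p * y) - 1)
  by (apply ln_le_sub_1, Rdiv_lt_0_compat; lra).
assert (H2 : ln (/ (1 + p * y)) <= / (1 + p * y) - 1)
  by (apply ln_le_sub_1, Rinv_0_lt_compat; lra).
unfold Rdiv in H1. rewrite ln_mult in H1 by (try apply Rinv_0_lt_compat; lra).
rewrite ln_Rinv in H1, H2 by easy.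
assert (H3 : p * ((1 + y) * / (1 + p * y) - 1) + (1 - p) * (/ (1 + p * y) - 1) = 0)
  by (field; lra).
nra.
Qed.

Lemma le_Rpower_of_le_1 (x p : R) : p <= 1 -> 0 < x <= 1 -> x <= Rpower x p.
Proof.
intros Hp [Hx Hx1]. rewrite <- (exp_ln x) at 1 by easy. apply exp_le.
assert (ln x <= 0) by (generalize (ln_le_sub_1 x Hx); lra). nra.
Qed.

(** A ratio z/(x+y) at most 1 does not exceed its own b-th power, and the ratios of x and y add up
    to 1. *)
Lemma Rpower_subadditive (x y b : R) : 0 < x -> 0 < y -> b <= 1 ->
  Rpower (x + y) b <= Rpower x b + Rpower y b.
Proof.
intros Hx Hy Hb.
assert (H : forall z, 0 < z <= x + y ->
  z / (x + y) * Rpower (x + y) b <= Rpower z b).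
{ intros z Hz.
  assert (Hd : 0 < z / (x + y) <= 1).
  { split; [apply Rdiv_lt_0_compat; lra|].
    apply (Rmult_le_reg_r (x + y)); [lra|]. field_simplify; lra. }
  replace (Rpower z b) with (Rpower (z / (x + y)) b * Rpower (x + y) b).
  - apply Rmult_le_compat_r; [left; apply Rpower_pos | now apply le_Rpower_of_le_1].
  - rewrite Rpower_mult_distr by lra. f_equal. field; lra. }
generalize (H x ltac:(lra)) (H y ltac:(lra)).
replace (Rpower (x + y) b) with
  (x / (x + y) * Rpower (x + y) b + y / (x + y) * Rpower (x + y) b) at 3
  by (field; lra).
lra.
Qed.

(* By how much [x |-> x^p] fails to be additive, from
   [(m + M)^p = M^p (1 + m/M)^p <= M^p (1 + p m/M)] and [m/M <= (m/M)^p]. *)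
Lemma Rpower_gap (p m M : R) : 0 <= p <= 1 -> 0 < m <= M ->
  (1 - p) * Rpower m p <= Rpower m p + Rpower M p - Rpower (m + M) p.
Proof.
intros Hp HmM.
assert (Hq : 0 < m / M <= 1).
{ split; [apply Rdiv_lt_0_compat; lra|].
  apply (Rmult_le_reg_r M); [lra|]. field_simplify; lra. }
replace (Rpower (m + M) p) with (Rpower (1 + m / M) p * Rpower M p)
  by (rewrite Rpower_mult_distr by lra; f_equal; field; lra).
assert (E : Rpower m p = Rpower (m / M) p * Rpower M p)
  by (rewrite Rpower_mult_distr by lra; f_equal; field; lra).
rewrite E.
generalize (Rpower_bernoulli p (m / M) Hp (proj1 Hq)).
generalize (le_Rpower_of_le_1 (m / M) p (proj2 Hp) Hq).
generalize (Rpower_pos M p).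
intros HM H1 H2.
assert (Rpower (1 + m / M) p <= 1 + p * Rpower (m / M) p) by nra.
nra.
Qed.

Lemma Rpower_small (K b eps : R) : 0 < b -> 0 < eps ->
  exists d, 0 < d /\ forall x, 0 < x < d -> K * Rpower x b <= eps.
Proof.
intros Hb He.
(* The solution of (|K| + 1) d^b = eps; adding 1 keeps the divisor positive when K = 0. *)
exists (Rpower (eps / (Rabs K + 1)) (/ b)).
split; [apply Rpower_pos|].
intros x Hx.
assert (HK : 0 < Rabs K + 1) by (generalize (Rabs_pos K); lra).
assert (H : Rpower x b < eps / (Rabs K + 1)).
{ apply (Rlt_Rpower_l _ _ b Hb) in Hx.
  rewrite Rpower_mult, Rinv_l, Rpower_1 in Hx; [easy | | lra].
  now apply Rdiv_lt_0_compat. }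
apply (Rmult_lt_compat_l (Rabs K + 1)) in H; [|easy].
replace ((Rabs K + 1) * (eps / (Rabs K + 1))) with eps in H by (field; lra).
generalize (Rpower_pos x b) (Rle_abs K). nra.
Qed.

(** Translates the index condition of the definitions, s^gamma < t, into the form used in the
    estimates. *)
Lemma Rpower_inv_lt (gamma s t : R) : 0 < gamma -> 0 < s -> 0 < t ->
  (Rpower s gamma < t <-> s < Rpower t (1 / gamma)).
Proof.
intros Hg Hs Ht. split; intros H.
- apply (conj (Rpower_pos s gamma)) in H.
  apply (Rlt_Rpower_l _ _ (1 / gamma)) in H; [|apply Rdiv_lt_0_compat; lra].
  rewrite Rpower_mult in H.
  replace (gamma * (1 / gamma)) with 1 in H by (field; lra).
  now rewrite Rpower_1 in H.
- apply (conj Hs) in H.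
  apply (Rlt_Rpower_l _ _ gamma) in H; [|lra].
  rewrite Rpower_mult in H.
  replace (1 / gamma * gamma) with 1 in H by (field; lra).
  now rewrite Rpower_1 in H.
Qed.

Lemma is_RInt_Rpower_majorant (t chi a b : R) :
  chi < 1 -> 0 < a <= b -> b < t ->
  is_RInt (fun x => Rpower x (- chi) + Rpower (t - x) (- chi)) a b
    ((Rpower b (1 - chi) - Rpower a (1 - chi)
      + (Rpower (t - a) (1 - chi) - Rpower (t - b) (1 - chi))) / (1 - chi)).
Proof.
intros Hc Hab Hb.
pose (P := fun x => (Rpower x (1 - chi) - Rpower (t - x) (1 - chi)) / (1 - chi)).
replace ((Rpower b (1 - chi) - Rpower a (1 - chi)
      + (Rpower (t - a) (1 - chi) - Rpower (t - b) (1 - chi))) / (1 - chi))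
  with (minus (P b) (P a)) by (unfold P, minus, plus, opp; simpl; field; lra).
assert (HD : forall x e, 0 < x ->
  is_derive (fun y => Rpower y e) x (e * Rpower x (e - 1)))
  by (intros x e Hx; apply is_derive_Reals, derivable_pt_lim_power; lra).
apply (is_RInt_derive (V := R_CompleteNormedModule) P);
  rewrite Rmin_left, Rmax_right by lra; intros x Hx.
- unfold P.
  assert (H1 := HD x (1 - chi) ltac:(lra)).
  assert (H2 := HD (t - x) (1 - chi) ltac:(lra)).
  replace (1 - chi - 1) with (- chi) in H1, H2 by ring.
  assert (H3 : is_derive (fun y => Rpower (t - y) (1 - chi)) x
    (scal (-1) ((1 - chi) * Rpower (t - x) (- chi)))).
  { apply (is_derive_comp (fun y => Rpower y (1 - chi)) (fun y => t - y)); [easy|].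
    auto_derive; [easy | ring]. }
  assert (H4 := is_derive_scal _ _ (/ (1 - chi)) _ (is_derive_minus _ _ _ _ _ H1 H3)).
  eapply is_derive_ext; [|eapply (eq_rect _ (is_derive _ _)); [exact H4|]].
  + intros y. cbv beta. unfold minus, plus, opp, scal; simpl.
    unfold Rdiv, Rminus. apply Rmult_comm.
  + unfold minus, plus, opp, scal; simpl; unfold mult; simpl. field; lra.
- apply (continuous_plus (fun y => Rpower y (- chi)) (fun y => Rpower (t - y) (- chi))).
  + apply (@ex_derive_continuous R_AbsRing R_NormedModule). eexists. apply HD. lra.
  + apply (continuous_comp (fun y => t - y) (fun y => Rpower y (- chi))).
    * apply (@ex_derive_continuous R_AbsRing R_NormedModule). auto_derive; easy.
    * apply (@ex_derive_continuous R_AbsRing R_NormedModule).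
      eexists. apply HD. lra.
Qed.

(** Subadditivity of z^(1-chi) bounds both differences in the primitive by (b-a)^(1-chi). The bound
    thus depends on the length alone, neither on t nor on the distance to the singular ends. *)
Lemma RInt_Rpower_majorant_le (t chi a b : R) :
  0 <= chi < 1 -> 0 < a <= b -> b < t ->
  exists I, is_RInt (fun x => Rpower x (- chi) + Rpower (t - x) (- chi)) a b I /\
    I <= 2 / (1 - chi) * Rpower (b - a) (1 - chi).
Proof.
intros Hc Hab Hb.
eexists; split; [apply is_RInt_Rpower_majorant; lra|].
assert (H : Rpower b (1 - chi) - Rpower a (1 - chi)
      + (Rpower (t - a) (1 - chi) - Rpower (t - b) (1 - chi))
      <= 2 * Rpower (b - a) (1 - chi)).
{ destruct (proj2 Hab) as [Hlt | ->].
  - generalize (Rpower_subadditive a (b - a) (1 - chi) ltac:(lra) ltac:(lra) ltac:(lra)).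
    generalize (Rpower_subadditive (t - b) (b - a) (1 - chi) ltac:(lra) ltac:(lra) ltac:(lra)).
    replace (a + (b - a)) with b by ring.
    replace (t - b + (b - a)) with (t - a) by ring. lra.
  - generalize (Rpower_pos (b - b) (1 - chi)). lra. }
unfold Rdiv. replace (2 * / (1 - chi) * Rpower (b - a) (1 - chi))
  with (2 * Rpower (b - a) (1 - chi) * / (1 - chi)) by ring.
apply Rmult_le_compat_r; [left; apply Rinv_0_lt_compat; lra | easy].
Qed.

(** * Subsequences and uniformity *)

Lemma nat_large (x : R) : exists n : nat, x < INR n.
Proof.
destruct (Rle_lt_dec x 0) as [H | H].
- exists 1%nat. simpl. lra.
- exists (Z.to_nat (up x)). destruct (archimed x) as [H1 _].
  rewrite INR_IZR_INZ, Z2Nat.id; [easy|].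
  apply le_IZR. lra.
Qed.

(** Compactness of the segment. Radius d and threshold N are merged into the one number min(d,
    1/(N+1)), with n >= N expressed through 1/(n+1), so that one covering argument makes both
    uniform. *)
Lemma uniform_on_segment (P : nat -> R -> Prop) (a b : R) :
  (forall x, a <= x <= b -> exists d N, 0 < d /\
     forall n y, (N <= n)%nat -> Rabs (y - x) < d -> P n y) ->
  exists N, forall n y, (N <= n)%nat -> a <= y <= b -> P n y.
Proof.
intros H.
assert (H' : forall x, exists d : posreal, a <= x <= b ->
  forall n y, / (INR n + 1) <= d -> Rabs (y - x) < d -> P n y).
{ intros x. destruct (classic (a <= x <= b)) as [Hx | Hx].
  - destruct (H x Hx) as (d & N & Hd & HP).
    assert (HN : 0 < / (INR N + 1)) by (apply Rinv_0_lt_compat; generalize (pos_INR N); lra).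
    exists (mkposreal _ (Rmin_stable_in_posreal (mkposreal d Hd) (mkposreal _ HN))).
    intros _ n y; simpl. intros Hn Hy. apply HP.
    + apply INR_le. apply Rnot_lt_le. intros Hlt.
      generalize (Rle_trans _ _ _ Hn (Rmin_r _ _)).
      apply Rlt_not_le. apply Rinv_lt_contravar; [|lra].
      generalize (pos_INR n) (pos_INR N); intros; nra.
    + generalize (Rmin_l d (/ (INR N + 1))). lra.
  - now exists (mkposreal 1 Rlt_0_1). }
apply choice in H'. destruct H' as [delta Hdelta].
destruct (compactness_value_1d a b delta) as [d Hd].
destruct (nat_large (/ d)) as [N HN].
exists N. intros n y Hn Hy.
apply NNPP. intros HP. apply (Hd y Hy). intros (x & Hx & Hyx & Hdx).
apply HP, (Hdelta x Hx); [|easy].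
apply Rle_trans with d; [|easy].
assert (Hpos := cond_pos d).
rewrite <- (Rinv_inv d). apply Rinv_le_contravar.
- now apply Rinv_0_lt_compat.
- apply le_INR in Hn. lra.
Qed.

Definition str_inc (k : nat -> nat) : Prop := forall n, (k n < k (S n))%nat.

Lemma str_inc_lt (k : nat -> nat) : str_inc k -> forall m n, (m < n)%nat -> (k m < k n)%nat.
Proof.
intros H m n Hmn. induction Hmn as [|n Hmn IH]; [apply H|].
specialize (H n). lia.
Qed.

Lemma str_inc_ge (k : nat -> nat) : str_inc k -> forall n, (n <= k n)%nat.
Proof.
intros H n. induction n as [|n IH]; [lia|]. specialize (H n). lia.
Qed.

(* Stability of [Q i] is required under passing to a sequence that eventually
   runs in the tails of the given one, as for convergence of a sequence along [k]. *)
Lemma diagonal_subsequence (Q : nat -> (nat -> nat) -> Prop) :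
  (forall i k, str_inc k -> exists k', str_inc k' /\ Q i (fun n => k (k' n))) ->
  (forall i k k', (exists M, forall n, (M <= n)%nat -> exists j, (n <= j)%nat /\ k' n = k j) ->
     Q i k -> Q i k') ->
  exists k, str_inc k /\ forall i, Q i k.
Proof.
intros Hex Hsub.
assert (Hstep : forall ik : nat * (nat -> nat), exists k', str_inc (snd ik) ->
  str_inc k' /\ Q (fst ik) (fun n => snd ik (k' n))).
{ intros [i k]. simpl. destruct (classic (str_inc k)) as [Hk | Hk].
  - destruct (Hex i k Hk) as [k' Hk']. now exists k'.
  - now exists (fun n => n). }
apply choice in Hstep. destruct Hstep as [next Hnext].
pose (K := fix K i : nat -> nat := match i with
  | O => fun n => n
  | S j => fun n => K j (next (j, K j) n)
  end).
assert (HK : forall i, str_inc (K i)).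
{ induction i as [|i IH]; [intros n; simpl; lia|].
  intros n. simpl. apply str_inc_lt; [easy|]. exact (proj1 (Hnext (i, K i) IH) n). }
assert (Hge : forall i n, (n <= next (i, K i) n)%nat)
  by (intros i; apply str_inc_ge; exact (proj1 (Hnext (i, K i) (HK i)))).
assert (HKsub : forall i j n, exists m, (n <= m)%nat /\ K (j + i)%nat n = K i m).
{ intros i j. induction j as [|j IH]; intros n; [now exists n|].
  destruct (IH (next ((j + i)%nat, K (j + i)%nat) n)) as (m & Hm & E).
  exists m. split; [|exact E]. exact (Nat.le_trans _ _ _ (Hge (j + i)%nat n) Hm). }
exists (fun n => K n n). split.
- intros n. change (K n n < K n (next (n, K n) (S n)))%nat.
  apply str_inc_lt; [apply HK|]. exact (Hge n (S n)).
- intros i. apply (Hsub i (K (S i))); [|exact (proj2 (Hnext (i, K i) (HK i)))].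
  (* [Q i] is secured by the refinement [K (S i)]; from n = S i on, the diagonal term is a term of
     [K (S i)] of index at least n. *)
  exists (S i). intros n Hn.
  destruct (HKsub (S i) (n - S i)%nat n) as (m & Hm & E).
  exists m. split; [easy|]. now replace (n - S i + S i)%nat with n in E by lia.
Qed.

(** Enumerates, with repetitions, the pairs of nonnegative rationals; they serve as (time, index) in
    the diagonal extraction. The successors keep the denominators nonzero. *)
Definition rat_pair (k : nat) : R * R :=
  let (a, b) := Cantor.of_nat k in
  let (i, j) := Cantor.of_nat a in
  let (l, m) := Cantor.of_nat b in
  (INR i / INR (S j), INR l / INR (S m)).

Lemma rat_dense (a b : R) : 0 <= a < b -> exists i j, a < INR i / INR (S j) < b.
Proof.
intros Hab.
destruct (nat_large (/ (b - a))) as [j Hj].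
assert (Hba : 0 < / (b - a)) by (apply Rinv_0_lt_compat; lra).
assert (HS : 0 < INR (S j)) by apply lt_0_INR, Nat.lt_0_succ.
assert (Hlen : 1 < (b - a) * INR (S j)).
{ apply Rmult_lt_reg_l with (/ (b - a)); [easy|].
  rewrite <- Rmult_assoc, Rinv_l, S_INR; lra. }
assert (Ha : 0 <= a * INR (S j)) by (apply Rmult_le_pos; lra).
destruct (archimed (a * INR (S j))) as [H1 H2].
assert (Hz : (0 <= up (a * INR (S j)))%Z) by (apply le_IZR; lra).
exists (Z.to_nat (up (a * INR (S j)))), j.
rewrite (INR_IZR_INZ (Z.to_nat _)), Z2Nat.id by easy.
split; apply (Rmult_lt_reg_r (INR (S j))); try easy;
  unfold Rdiv; rewrite Rmult_assoc, Rinv_l by lra; lra.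
Qed.

Lemma rat_pair_dense (a b c d : R) : 0 <= a < b -> 0 <= c < d ->
  exists k, a < fst (rat_pair k) < b /\ c < snd (rat_pair k) < d.
Proof.
intros Hab Hcd.
destruct (rat_dense a b Hab) as (i & j & H1).
destruct (rat_dense c d Hcd) as (l & m & H2).
exists (Cantor.to_nat (Cantor.to_nat (i, j), Cantor.to_nat (l, m))).
unfold rat_pair. now rewrite !Cantor.cancel_of_to.
Qed.

(** * Linear identities in modules *)

(** Syntax for a proof by reflection: a term over a list of atoms is normalized to its coefficient
    function, which turns an identity of vectors into finitely many identities of reals. *)
Inductive mod_expr :=
  | MVar (i : nat) | MZero | MPlus (e1 e2 : mod_expr) | MOpp (e : mod_expr)
  | MScal (k : R) (e : mod_expr).

Fixpoint mod_coef (e : mod_expr) (i : nat) : R :=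
  match e with
  | MVar j => if Nat.eqb i j then 1 else 0
  | MZero => 0
  | MPlus e1 e2 => mod_coef e1 i + mod_coef e2 i
  | MOpp e => - mod_coef e i
  | MScal k e => k * mod_coef e i
  end.

Section ModuleEquations.
Context {V : ModuleSpace R_Ring}.

Fixpoint mod_eval (env : list V) (e : mod_expr) : V :=
  match e with
  | MVar i => List.nth i env zero
  | MZero => zero
  | MPlus e1 e2 => plus (mod_eval env e1) (mod_eval env e2)
  | MOpp e => opp (mod_eval env e)
  | MScal k e => scal k (mod_eval env e)
  end.

Fixpoint lin_comb (c : nat -> R) (env : list V) : V :=
  match env with
  | nil => zero
  | cons x env' => plus (scal (c 0%nat) x) (lin_comb (fun i => c (S i)) env')
  end.

Lemma lin_comb_ext (c d : nat -> R) (env : list V) :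
  (forall i, c i = d i) -> lin_comb c env = lin_comb d env.
Proof.
revert c d. induction env as [|x env IH]; intros c d H; simpl; [easy|].
rewrite H. f_equal. now apply IH.
Qed.

Lemma lin_comb_zero (env : list V) : lin_comb (fun _ => 0) env = zero.
Proof.
induction env as [|x env IH]; simpl; [easy|].
rewrite IH. change 0 with (@zero R_Ring). now rewrite scal_zero_l, plus_zero_l.
Qed.

Lemma lin_comb_plus (c d : nat -> R) (env : list V) :
  lin_comb (fun i => c i + d i) env = plus (lin_comb c env) (lin_comb d env).
Proof.
revert c d. induction env as [|x env IH]; intros c d; simpl; [now rewrite plus_zero_l|].
rewrite (IH (fun i => c (S i)) (fun i => d (S i))).
rewrite (scal_distr_r (c 0%nat) (d 0%nat) x : scal (c 0%nat + d 0%nat) x = _).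
rewrite <- !plus_assoc. f_equal. rewrite !plus_assoc. f_equal. apply plus_comm.
Qed.

Lemma lin_comb_scal (k : R) (c : nat -> R) (env : list V) :
  lin_comb (fun i => k * c i) env = scal k (lin_comb c env).
Proof.
revert c. induction env as [|x env IH]; intros c; simpl; [now rewrite scal_zero_r|].
rewrite (IH (fun i => c (S i))), scal_distr_l. f_equal.
symmetry. apply (scal_assoc k (c 0%nat) x).
Qed.

Lemma lin_comb_var (j : nat) (env : list V) :
  lin_comb (fun i => if Nat.eqb i j then 1 else 0) env = List.nth j env zero.
Proof.
revert j. induction env as [|x env IH]; intros j; simpl; [now destruct j|].
destruct j as [|j]; simpl.
- rewrite lin_comb_zero, plus_zero_r. apply (scal_one x).
- rewrite IH. change 0 with (@zero R_Ring). now rewrite scal_zero_l, plus_zero_l.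
Qed.

Lemma mod_eval_lin_comb (env : list V) (e : mod_expr) :
  mod_eval env e = lin_comb (mod_coef e) env.
Proof.
induction e as [i | | e1 IH1 e2 IH2 | e IH | k e IH]; simpl.
- symmetry. apply lin_comb_var.
- symmetry. apply lin_comb_zero.
- now rewrite IH1, IH2, <- lin_comb_plus.
- rewrite IH, <- scal_opp_one, <- (lin_comb_scal (opp one)).
  apply lin_comb_ext. intros i. unfold opp, one; simpl. ring.
- now rewrite IH, <- lin_comb_scal.
Qed.

(** A recursive conjunction, so that [simpl] on a concrete list leaves one goal for [ring] per
    atom. *)
Fixpoint same_coefs (e1 e2 : mod_expr) (n : nat) : Prop :=
  match n with
  | O => True
  | S m => mod_coef e1 m = mod_coef e2 m /\ same_coefs e1 e2 m
  end.

Lemma mod_eval_eq (env : list V) (e1 e2 : mod_expr) :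
  same_coefs e1 e2 (length env) -> mod_eval env e1 = mod_eval env e2.
Proof.
intros H. rewrite !mod_eval_lin_comb.
assert (H' : forall i, (i < length env)%nat -> mod_coef e1 i = mod_coef e2 i).
{ revert H. generalize (length env) as n. induction n as [|n IH]; intros H i Hi; [lia|].
  destruct H as [H1 H2]. destruct (Nat.eq_dec i n) as [-> | Hne]; [easy|].
  apply IH; [easy | lia]. }
clear H. revert H'. generalize (mod_coef e1) (mod_coef e2).
induction env as [|x env IH]; intros c d H; simpl; [easy|].
rewrite (H 0%nat) by (simpl; lia). f_equal. apply IH.
intros i Hi. apply H. simpl. lia.
Qed.

End ModuleEquations.

Ltac mod_find x l :=
  match l with
  | cons x _ => constr:(O)
  | cons _ ?l' => let n := mod_find x l' in constr:(S n)
  end.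

Ltac mod_atoms l e :=
  match e with
  | zero => l
  | plus ?a ?b => let l := mod_atoms l a in mod_atoms l b
  | minus ?a ?b => let l := mod_atoms l a in mod_atoms l b
  | opp ?a => mod_atoms l a
  | scal _ ?a => mod_atoms l a
  (* The first branch succeeds when [e] is already listed; otherwise [mod_find] fails and
     backtracking adds [e]. *)
  | _ => match l with
         | _ => let n := mod_find e l in l
         | _ => constr:(cons e l)
         end
  end.

Ltac mod_reify l e :=
  match e with
  | zero => constr:(MZero)
  | plus ?a ?b => let a := mod_reify l a in let b := mod_reify l b in constr:(MPlus a b)
  | minus ?a ?b =>
      let a := mod_reify l a in let b := mod_reify l b in constr:(MPlus a (MOpp b))
  | opp ?a => let a := mod_reify l a in constr:(MOpp a)
  | scal ?k ?a => let a := mod_reify l a in constr:(MScal k a)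
  | _ => let n := mod_find e l in constr:(MVar n)
  end.

(* Proves an identity between linear combinations by comparing coefficients. *)
Ltac module_ring V :=
  match goal with
  | |- ?x = ?y =>
    let l := mod_atoms (@nil (ModuleSpace.sort R_Ring V)) x in
    let l := mod_atoms l y in
    let e1 := mod_reify l x in
    let e2 := mod_reify l y in
    refine (@mod_eval_eq V l e1 e2 _);
    simpl; repeat split; try ring
  end.

(** * Convergence in norm and integrals of linear images *)

(** Balls and norm of a [NormedModule] agree only up to [norm_factor]. This removes the factor and
    passes to non-strict inequalities, the form in which [cball] states estimates. *)
Lemma filterlim_norm_le {I : Type} {X : NormedModule R_AbsRing} (F : (I -> Prop) -> Prop)
  {FF : Filter F} (f : I -> X) (l : X) :
  filterlim f F (locally l) <->
  forall eps, 0 < eps -> F (fun i => norm (minus (f i) l) <= eps).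
Proof.
split.
- intros H eps He.
  assert (Hd : 0 < eps / @norm_factor _ X)
    by (apply Rdiv_lt_0_compat; [easy | apply norm_factor_gt_0]).
  generalize (proj1 (filterlim_locally f l) H (mkposreal _ Hd)).
  apply filter_imp. intros i Hi. left.
  apply norm_compat2 in Hi. simpl in Hi.
  replace (@norm_factor _ X * (eps / @norm_factor _ X)) with eps in Hi; [easy|].
  field. apply Rgt_not_eq, norm_factor_gt_0.
- intros H. apply filterlim_locally. intros eps.
  assert (He := cond_pos eps).
  generalize (H (eps / 2) ltac:(lra)). apply filter_imp. intros i Hi.
  apply norm_compat1. lra.
Qed.

Lemma Riemann_sum_linear {X Y : ModuleSpace R_Ring} (L : X -> Y) (f : R -> X) (ptd : SF_seq) :
  (forall x y, L (plus x y) = plus (L x) (L y)) ->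
  (forall k x, L (scal k x) = scal k (L x)) ->
  Riemann_sum (fun t => L (f t)) ptd = L (Riemann_sum f ptd).
Proof.
intros HP HS.
assert (H0 : L zero = zero).
{ transitivity (L (scal (@zero R_Ring) (@zero X))).
  - f_equal. symmetry. apply scal_zero_l.
  - rewrite HS. apply scal_zero_l. }
apply SF_cons_ind with (s := ptd).
- intros x. easy.
- intros h s IH. rewrite !Riemann_sum_cons, IH, HP, HS. easy.
Qed.

Lemma is_RInt_linear {X Y : NormedModule R_AbsRing} (L : X -> Y) (M : R) (f : R -> X)
  (a b : R) (I : X) :
  (forall x y, L (plus x y) = plus (L x) (L y)) ->
  (forall k x, L (scal k x) = scal k (L x)) ->
  (forall x, norm (L x) <= M * norm x) ->
  is_RInt f a b I -> is_RInt (fun t => L (f t)) a b (L I).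
Proof.
intros HP HS HM HI.
assert (HL : is_linear L).
{ split; [exact HP | exact HS |].
  exists (Rabs M + 1). split; [generalize (Rabs_pos M); lra|].
  intros x. generalize (HM x) (norm_ge_0 x) (Rle_abs M). intros; nra. }
unfold is_RInt in *.
apply filterlim_ext with (fun ptd => L (scal (sign (b - a)) (Riemann_sum f ptd))).
- intros ptd. rewrite HS. f_equal. symmetry. now apply (Riemann_sum_linear L).
- apply filterlim_comp with (1 := HI). apply (linear_cont L I HL).
Qed.

(** * Norm estimates and integrals in a scale *)

Section Scale.
Context {V : ModuleSpace R_Ring}.
Implicit Types (E : scale V) (v w : V).

(* Junk value when [v] does not belong to [E s]. *)
Definition lift E (s : R) v : E s := epsilon (inhabits zero) (fun x => emb x = v).

Lemma emb_lift E s v : mem E s v -> emb (lift E s v) = v.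
Proof. intros H. exact (epsilon_spec _ (fun x : E s => emb x = v) H). Qed.

Lemma lift_emb E s (x : E s) : 0 < s -> lift E s (emb x) = x.
Proof. intros Hs. apply (emb_inj Hs), emb_lift. now exists x. Qed.

Lemma emb_zero E s : 0 < s -> emb (zero : E s) = zero.
Proof.
intros Hs. transitivity (emb (scal (@zero R_Ring) (zero : E s))).
- f_equal. symmetry. apply (scal_zero_l (zero : E s)).
- rewrite (emb_scal Hs). apply (scal_zero_l (K := R_Ring)).
Qed.

Lemma emb_minus E s (x y : E s) : 0 < s -> emb (minus x y) = minus (emb x) (emb y).
Proof.
intros Hs. transitivity (emb (plus x (scal (-1) y))).
- unfold minus. do 2 f_equal. symmetry. apply (scal_opp_one y).
- rewrite emb_plus, emb_scal by easy. module_ring V.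
Qed.

Lemma cball_minus_zero E s r v : cball E s r v -> cball E s r (minus v zero).
Proof. replace (minus v zero) with v by module_ring V. easy. Qed.

Lemma cball_mem E s r v : cball E s r v -> mem E s v.
Proof. intros (x & Hx & _). now exists x. Qed.

Lemma mem_cball E s v : mem E s v -> exists r, 0 <= r /\ cball E s r v.
Proof.
intros [x Hx]. exists (norm x). split; [apply norm_ge_0|]. exists x. split; [easy | lra].
Qed.

Lemma cball_lift E s r v : 0 < s -> (cball E s r v <-> mem E s v /\ norm (lift E s v) <= r).
Proof.
intros Hs. split.
- intros (x & <- & Hx). split; [now exists x|]. now rewrite lift_emb.
- intros [Hm Hn]. exists (lift E s v). now rewrite emb_lift.
Qed.

Lemma cball_le E s r r' v : r <= r' -> cball E s r v -> cball E s r' v.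
Proof. intros Hr (x & Hx & Hn). exists x. split; [easy | lra]. Qed.

Lemma cball_zero E s r : 0 < s -> 0 <= r -> cball E s r zero.
Proof. intros Hs Hr. exists zero.
split; [now apply emb_zero|].
apply Rle_trans with 0; [right; exact (norm_zero (V := E s)) | easy].
Qed.

Lemma cball_plus E s r r' v w : 0 < s -> cball E s r v -> cball E s r' w ->
  cball E s (r + r') (plus v w).
Proof.
intros Hs (x & <- & Hx) (y & <- & Hy). exists (plus x y). split; [now apply emb_plus|].
apply Rle_trans with (1 := norm_triangle (V := E s) x y). now apply Rplus_le_compat.
Qed.

Lemma cball_scal E s r k v : 0 < s -> cball E s r v -> cball E s (Rabs k * r) (scal k v).
Proof.
intros Hs (x & <- & Hx). exists (scal k x). split; [now apply emb_scal|].
apply Rle_trans with (1 := norm_scal (V := E s) k x).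
apply Rmult_le_compat_l; [apply Rabs_pos | easy].
Qed.

Lemma cball_opp E s r v : 0 < s -> cball E s r v -> cball E s r (opp v).
Proof.
intros Hs H. replace (opp v) with (scal (-1) v) by module_ring V.
replace r with (Rabs (-1) * r) by (rewrite Rabs_m1; ring). now apply cball_scal.
Qed.

Lemma cball_minus E s r r' v w : 0 < s -> cball E s r v -> cball E s r' w ->
  cball E s (r + r') (minus v w).
Proof. intros Hs Hv Hw. apply cball_plus; [easy | easy | now apply cball_opp]. Qed.

Lemma cball_minus_sym E s r v w : 0 < s -> cball E s r (minus v w) -> cball E s r (minus w v).
Proof.
intros Hs H. replace (minus w v) with (opp (minus v w)) by module_ring V. now apply cball_opp.
Qed.

Lemma cball_triangle E s r r' a b c : 0 < s ->
  cball E s r (minus a b) -> cball E s r' (minus b c) -> cball E s (r + r') (minus a c).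
Proof.
intros Hs H H'. replace (minus a c) with (plus (minus a b) (minus b c)) by module_ring V.
now apply cball_plus.
Qed.

Lemma cball_closed E s r v : 0 < s -> (forall eps, 0 < eps -> cball E s (r + eps) v) ->
  cball E s r v.
Proof.
intros Hs H. apply (cball_lift E s r v Hs).
split; [exact (cball_mem _ _ _ _ (H 1 Rlt_0_1))|].
apply Rnot_lt_le. intros Hlt.
generalize (proj2 (proj1 (cball_lift _ _ _ _ Hs) (H ((norm (lift E s v) - r) / 2) ltac:(lra)))).
lra.
Qed.

Lemma cball_separated E s v : 0 < s -> (forall eps, 0 < eps -> cball E s eps v) -> v = zero.
Proof.
intros Hs H.
assert (H0 : cball E s 0 v)
  by (apply cball_closed; [easy | intros eps He; now rewrite Rplus_0_l; apply H]).
destruct H0 as (x & <- & Hx). replace x with (zero : E s); [now apply emb_zero|].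
symmetry. apply (@norm_eq_zero R_AbsRing (E s)). apply Rle_antisym; [easy | apply norm_ge_0].
Qed.

Lemma mem_plus E s v w : 0 < s -> mem E s v -> mem E s w -> mem E s (plus v w).
Proof. intros Hs [x <-] [y <-]. exists (plus x y). now apply emb_plus. Qed.

Lemma mem_scal E s k v : 0 < s -> mem E s v -> mem E s (scal k v).
Proof. intros Hs [x <-]. exists (scal k x). now apply emb_scal. Qed.

Lemma mem_minus E s v w : 0 < s -> mem E s v -> mem E s w -> mem E s (minus v w).
Proof.
intros Hs Hv Hw. replace (minus v w) with (plus v (scal (-1) w)) by module_ring V.
apply mem_plus; [easy | easy | now apply mem_scal].
Qed.

Lemma lift_plus E s v w : 0 < s -> mem E s v -> mem E s w ->
  lift E s (plus v w) = plus (lift E s v) (lift E s w).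
Proof. intros Hs [x <-] [y <-]. rewrite <- emb_plus by easy. now rewrite !lift_emb. Qed.

Lemma lift_scal E s k v : 0 < s -> mem E s v -> lift E s (scal k v) = scal k (lift E s v).
Proof. intros Hs [x <-]. rewrite <- emb_scal by easy. now rewrite !lift_emb. Qed.

Lemma lift_minus E s v w : 0 < s -> mem E s v -> mem E s w ->
  lift E s (minus v w) = minus (lift E s v) (lift E s w).
Proof.
intros Hs [x <-] [y <-]. rewrite <- emb_minus by easy. now rewrite !lift_emb.
Qed.

Lemma cball_nested E s s' r v : norm_monotone E -> 0 < s <= s' -> cball E s' r v -> cball E s r v.
Proof.
intros HE [Hs [Hlt | ->]] H; [|easy].
(* The spaces are indexed by reals, so the index must take the form [s + delta] before its element
   is unpacked. *)
replace s' with (s + (s' - s)) in H by ring.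
destruct H as (x & <- & Hx).
apply cball_le with (1 := Hx). apply HE; lra.
Qed.

(** Convergence in the norm of [E s] for elements of [V]. Only the differences have to lie in [E s],
    so one family can be examined in several spaces of the scale. *)
Definition tends {I : Type} (F : (I -> Prop) -> Prop) E (s : R) (y : I -> V) (l : V) : Prop :=
  forall eps, 0 < eps -> F (fun i => cball E s eps (minus (y i) l)).

Lemma tends_lift {I : Type} (F : (I -> Prop) -> Prop) {FF : Filter F} E s (y : I -> V) l :
  0 < s -> mem E s l -> tends F E s y l ->
  filterlim (fun i => lift E s (y i)) F (locally (lift E s l)).
Proof.
intros Hs Hl H. apply (filterlim_norm_le (X := E s) F). intros eps He.
generalize (H eps He). apply filter_imp. intros i Hi.
apply cball_lift in Hi; [|easy]. destruct Hi as [Hm Hn].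
rewrite lift_minus in Hn; try easy.
replace (y i) with (plus (minus (y i) l) l) by module_ring V. now apply mem_plus.
Qed.

Lemma scale_complete E s (y : nat -> V) : 0 < s -> (forall n, mem E s (y n)) ->
  (forall eps, 0 < eps -> exists N, forall n m, (N <= n)%nat -> (N <= m)%nat ->
     cball E s eps (minus (y n) (y m))) ->
  exists l, mem E s l /\ tends eventually E s y l.
Proof.
intros Hs Hm HC.
destruct (proj1 (filterlim_locally_cauchy (U := E s) (F := eventually)
  (fun n => lift E s (y n)))) as [l Hl].
- intros eps. assert (He := cond_pos eps).
  destruct (HC (eps / 2) ltac:(lra)) as [N HN].
  exists (fun n => (N <= n)%nat). split; [now exists N|].
  intros n m Hn Hm'. apply (@norm_compat1 R_AbsRing (E s)).
  destruct (proj1 (cball_lift _ _ _ _ Hs) (HN m n Hm' Hn)) as [_ H].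
  rewrite lift_minus in H by easy. apply Rle_lt_trans with (1 := H). lra.
- exists (emb l). split; [now exists l|].
  intros eps He. assert (Hl' := proj1 (filterlim_norm_le (X := E s) eventually _ l) Hl).
  generalize (Hl' eps He). apply filter_imp. intros n Hn.
  exists (minus (lift E s (y n)) l). split; [|easy].
  rewrite emb_minus by easy. now rewrite emb_lift.
Qed.

Lemma tends_unique E s (y : nat -> V) l l' : 0 < s ->
  tends eventually E s y l -> tends eventually E s y l' -> l = l'.
Proof.
intros Hs H H'.
assert (H0 : minus l l' = zero).
{ apply (cball_separated E s); [easy|]. intros eps He.
  destruct (H (eps / 2) ltac:(lra)) as [N HN].
  destruct (H' (eps / 2) ltac:(lra)) as [N' HN'].
  replace eps with (eps / 2 + eps / 2) by field.
  apply cball_triangle with (y (max N N')); [easy | |].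
  - apply cball_minus_sym; [easy|]. apply HN. lia.
  - apply HN'. lia. }
replace l with (plus (minus l l') l') by module_ring V. rewrite H0. apply plus_zero_l.
Qed.

(** A proper Riemann integral in [E s], made a relation on [V] so that the same value can be tested
    in different spaces. The membership clauses keep the junk values of [lift] out. *)
Definition seg_int E (s : R) (g : R -> V) (a b : R) v : Prop :=
  a <= b /\ (forall x, a <= x <= b -> mem E s (g x)) /\ mem E s v /\
  is_RInt (fun x => lift E s (g x)) a b (lift E s v).

Lemma seg_int_exists E s g a b : 0 < s -> a <= b ->
  (forall x, a <= x <= b -> mem E s (g x) /\ tends (locally x) E s g (g x)) ->
  seg_int E s g a b (emb (RInt (fun x => lift E s (g x)) a b)).
Proof.
intros Hs Hab Hg. split; [easy|]. split; [intros x Hx; now apply Hg|].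
split; [now eexists|].
rewrite lift_emb by easy. apply (RInt_correct (V := E s)), ex_RInt_continuous.
intros x. rewrite Rmin_left, Rmax_right by easy. intros Hx.
destruct (Hg x Hx) as [Hm Ht]. now apply tends_lift; [apply locally_filter | | |].
Qed.

Lemma seg_int_unique E s g a b v w : seg_int E s g a b v -> seg_int E s g a b w -> v = w.
Proof.
intros (_ & _ & Hv & Iv) (_ & _ & Hw & Iw).
rewrite <- (emb_lift E s v Hv), <- (emb_lift E s w Hw). f_equal.
rewrite <- (is_RInt_unique _ _ _ _ Iv). now apply is_RInt_unique.
Qed.

(** Bounded operators commute with the integral. Used for S^t and, with the identity of [V] as [L],
    for the embeddings of the scale. *)
Lemma seg_int_op E (E' : scale V) s s' (L : V -> V) M g a b v : 0 < s -> 0 < s' ->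
  (forall v w, mem E s v -> mem E s w -> L (plus v w) = plus (L v) (L w)) ->
  (forall k v, mem E s v -> L (scal k v) = scal k (L v)) ->
  (forall r v, cball E s r v -> cball E' s' (M * r) (L v)) ->
  seg_int E s g a b v -> seg_int E' s' (fun x => L (g x)) a b (L v).
Proof.
intros Hs Hs' HP HS HM (Hab & Hg & Hv & I).
assert (Hmem : forall w, mem E s w -> mem E' s' (L w)).
{ intros w Hw. destruct (mem_cball _ _ _ Hw) as (r & _ & Hr). eapply cball_mem, HM, Hr. }
split; [easy|]. split; [intros x Hx; now apply Hmem, Hg|]. split; [now apply Hmem|].
(* [L] enters as the operator it induces between the two Banach spaces, through [emb] and [lift]. *)
assert (HJ := is_RInt_linear (X := E s) (Y := E' s') (fun x => lift E' s' (L (emb x))) M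
   (fun x => lift E s (g x)) a b (lift E s v)).
cbv beta in HJ. rewrite emb_lift in HJ by easy.
eapply (is_RInt_ext (V := E' s')); [|apply HJ].
- intros x. rewrite Rmin_left, Rmax_right by easy. intros Hx. simpl.
  rewrite emb_lift; [easy|]. apply Hg. lra.
- intros x y. rewrite emb_plus by easy. rewrite HP by (now eexists).
  apply lift_plus; [easy | |]; apply Hmem; now eexists.
- intros k x. rewrite emb_scal by easy. rewrite HS by (now eexists).
  apply lift_scal; [easy|]; apply Hmem; now eexists.
- intros x. apply cball_lift; [easy|]. apply HM. exists x. split; [easy | lra].
- easy.
Qed.

Lemma seg_int_nested E s s' g a b v : norm_monotone E -> 0 < s <= s' ->
  seg_int E s' g a b v -> seg_int E s g a b v.
Proof.
intros HE Hs. apply (seg_int_op E E s' s (fun v => v) 1 g); try easy; try lra.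
intros r w Hw. rewrite Rmult_1_l. now apply cball_nested with s'.
Qed.

Lemma seg_int_ext E s g g' a b v : (forall x, a <= x <= b -> g x = g' x) ->
  seg_int E s g a b v -> seg_int E s g' a b v.
Proof.
intros H (Hab & Hg & Hv & I). split; [easy|].
split; [intros x Hx; rewrite <- H by easy; now apply Hg|]. split; [easy|].
apply is_RInt_ext with (2 := I). intros x. rewrite Rmin_left, Rmax_right by easy.
intros Hx. rewrite H; [easy | lra].
Qed.

Lemma seg_int_Chasles E s g a b c v w : 0 < s ->
  seg_int E s g a b v -> seg_int E s g b c w -> seg_int E s g a c (plus v w).
Proof.
intros Hs (Hab & Hg & Hv & I) (Hbc & Hg' & Hw & J).
split; [lra|]. split.
- intros x Hx. destruct (Rle_lt_dec x b); [apply Hg | apply Hg']; lra.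
- split; [now apply mem_plus|]. rewrite lift_plus by easy.
  now apply (is_RInt_Chasles (V := E s)) with b.
Qed.

Lemma seg_int_minus E s g g' a b v w : 0 < s ->
  seg_int E s g a b v -> seg_int E s g' a b w ->
  seg_int E s (fun x => minus (g x) (g' x)) a b (minus v w).
Proof.
intros Hs (Hab & Hg & Hv & I) (_ & Hg' & Hw & J).
split; [easy|]. split; [intros x Hx; apply mem_minus; auto|].
split; [now apply mem_minus|]. rewrite lift_minus by easy.
eapply (is_RInt_ext (V := E s)); [|exact (is_RInt_minus (V := E s) _ _ _ _ _ _ I J)].
intros x. rewrite Rmin_left, Rmax_right by easy. intros Hx. simpl.
rewrite lift_minus; [easy | easy | apply Hg; lra | apply Hg'; lra].
Qed.

Lemma seg_int_const E s a b v : 0 < s -> a <= b -> mem E s v ->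
  seg_int E s (fun _ => v) a b (scal (b - a) v).
Proof.
intros Hs Hab Hv. split; [easy|]. split; [easy|]. split; [now apply mem_scal|].
rewrite lift_scal by easy. apply (is_RInt_const (V := E s)).
Qed.

Lemma seg_int_norm E s g m a b v I : 0 < s ->
  (forall x, a <= x <= b -> cball E s (m x) (g x)) -> is_RInt m a b I ->
  seg_int E s g a b v -> cball E s I v.
Proof.
intros Hs Hm HI (Hab & Hg & Hv & J). apply cball_lift; [easy|]. split; [easy|].
apply (norm_RInt_le (V := E s)) with (3 := J) (4 := HI); [easy|].
intros x Hx. now apply cball_lift; [|apply Hm].
Qed.

Lemma seg_int_norm_const E s g K a b v : 0 < s ->
  (forall x, a <= x <= b -> cball E s K (g x)) ->
  seg_int E s g a b v -> cball E s ((b - a) * K) v.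
Proof.
intros Hs HK. apply seg_int_norm with (fun _ => K); [easy | easy |].
apply (is_RInt_const (V := R_NormedModule)).
Qed.

End Scale.

(** * One-sided neighbourhoods, improper integrals, uniform boundedness *)

Lemma at_right_0 (P : R -> Prop) :
  at_right 0 P <-> exists d, 0 < d /\ forall t, 0 < t < d -> P t.
Proof.
split.
- intros [d Hd]. exists d. split; [apply cond_pos|]. intros t Ht. apply Hd; [|easy].
  unfold ball; simpl; unfold AbsRing_ball, abs, minus, plus, opp; simpl.
  rewrite Rabs_pos_eq; lra.
- intros (d & Hd & H). exists (mkposreal d Hd). intros t Ht Ht0. apply H.
  unfold ball in Ht; simpl in Ht; unfold AbsRing_ball, abs, minus, plus, opp in Ht; simpl in Ht.
  generalize (Rle_abs (t + - 0)). lra.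
Qed.

Lemma locally_R (x : R) (P : R -> Prop) :
  locally x P <-> exists d, 0 < d /\ forall t, Rabs (t - x) < d -> P t.
Proof.
split.
- intros [d Hd]. exists d. split; [apply cond_pos|]. exact Hd.
- intros (d & Hd & H). exists (mkposreal d Hd). exact H.
Qed.

Lemma at_left_R (t : R) (P : R -> Prop) :
  at_left t P <-> exists d, 0 < d /\ forall b, t - d < b < t -> P b.
Proof.
unfold at_left, within. rewrite locally_R. split; intros (d & Hd & H).
- exists d. split; [easy|]. intros b Hb. apply H; [|easy]. apply Rabs_def1; lra.
- exists d. split; [easy|]. intros b Hb Hbt. apply H. apply Rabs_def2 in Hb. lra.
Qed.

Lemma is_derive_norm {X : NormedModule R_AbsRing} (w : R -> X) (t : R) (d : X) :
  (forall eps, 0 < eps -> exists delta, 0 < delta /\ forall r, Rabs (r - t) < delta ->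
     norm (minus (minus (w r) (w t)) (scal (r - t) d)) <= eps * Rabs (r - t)) ->
  is_derive w t d.
Proof.
intros H. split; [apply is_linear_scal_l|].
intros y Hy eps. rewrite <- (is_filter_lim_locally_unique (V := R_NormedModule) t y Hy).
apply locally_R. destruct (H eps (cond_pos eps)) as (delta & Hdelta & Hr).
exists delta. split; [easy|]. exact Hr.
Qed.

(** Cauchy criterion: integrals over intervals close to (0,t) differ from the one over a fixed
    [d, t-d] by two end pieces of length below d, each small by the hypothesis. *)
Lemma ex_RInt_gen_of_tail_bound (h : R -> R) (t K b : R) : 0 < t -> 0 < b ->
  (forall x, 0 < x < t -> continuous h x) ->
  (forall x y I, 0 < x <= y -> y < t -> is_RInt h x y I -> Rabs I <= K * Rpower (y - x) b) ->
  ex_RInt_gen h (at_right 0) (at_left t).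
Proof.
intros Ht Hb Hcont HK.
assert (Hint : forall x y, 0 < x < t -> 0 < y < t -> ex_RInt h x y).
{ intros x y Hx Hy. apply (ex_RInt_continuous (V := R_CompleteNormedModule)).
  intros z Hz. apply Hcont. split.
  - apply Rlt_le_trans with (2 := proj1 Hz). now apply Rmin_glb_lt.
  - apply Rle_lt_trans with (1 := proj2 Hz). now apply Rmax_lub_lt. }
assert (Hnear : forall d, 0 < d -> d < t ->
  filter_prod (at_right 0) (at_left t) (fun ab => 0 < fst ab < d /\ t - d < snd ab < t)).
{ intros d Hd Hdt. exists (fun a => 0 < a < d) (fun b => t - d < b < t).
  - apply at_right_0. now exists d.
  - apply at_left_R. now exists d.
  - easy. }
unfold ex_RInt_gen, is_RInt_gen.
apply (filterlimi_locally_cauchy (U := R_CompleteNormedModule)).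
- generalize (Hnear (t / 2) ltac:(lra) ltac:(lra)). apply filter_imp. intros [x y] [Hx Hy].
  simpl in Hx, Hy |- *. split.
  + apply (Hint x y); lra.
  + intros y1 y2 H1 H2. rewrite <- (is_RInt_unique (V := R_CompleteNormedModule) _ _ _ _ H1).
    now apply (is_RInt_unique (V := R_CompleteNormedModule)).
- intros eps. assert (He := cond_pos eps).
  (* Two integrals with two end pieces each give four fifths of [eps], which leaves the final
     inequality strict. *)
  destruct (Rpower_small K b (eps / 5)) as (d0 & Hd0 & Hsmall); try easy; try lra.
  pose (d := Rmin d0 (t / 2) / 2).
  assert (Hd : 0 < d /\ d < d0 /\ d < t / 2).
  { assert (0 < Rmin d0 (t / 2)) by (apply Rmin_glb_lt; lra).
    generalize (Rmin_l d0 (t / 2)) (Rmin_r d0 (t / 2)). unfold d. lra. }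
  destruct (Hint d (t - d)) as [J HJ]; try lra.
  assert (Htail : forall x y I, 0 < x < d -> t - d < y < t -> is_RInt h x y I ->
    Rabs (I - J) <= 2 * (eps / 5)).
  { intros x y I Hx Hy HI.
    destruct (Hint x d) as [I1 HI1]; try lra.
    destruct (Hint (t - d) y) as [I2 HI2]; try lra.
    assert (E : I = plus (plus I1 J) I2).
    { rewrite <- (is_RInt_unique (V := R_CompleteNormedModule) _ _ _ _ HI).
      apply (is_RInt_unique (V := R_CompleteNormedModule)).
      apply (is_RInt_Chasles (V := R_NormedModule)) with (t - d); [|easy].
      now apply (is_RInt_Chasles (V := R_NormedModule)) with d. }
    assert (H1 := HK x d I1 ltac:(lra) ltac:(lra) HI1).
    assert (H2 := HK (t - d) y I2 ltac:(lra) ltac:(lra) HI2).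
    generalize (Hsmall (d - x) ltac:(lra)) (Hsmall (y - (t - d)) ltac:(lra)). intros H3 H4.
    replace (I - J) with (I1 + I2) by (rewrite E; unfold plus; simpl; ring).
    apply Rle_trans with (1 := Rabs_triang _ _). lra. }
  exists (fun ab => 0 < fst ab < d /\ t - d < snd ab < t). split; [apply Hnear; lra|].
  intros [x y] [x' y'] [Hx Hy] [Hx' Hy'] I I' HI HI'. simpl in *.
  assert (H1 := Htail _ _ _ Hx Hy HI). assert (H2 := Htail _ _ _ Hx' Hy' HI').
  apply (@norm_compat1 R_AbsRing R_NormedModule).
  change (Rabs (I' - I) < eps).
  replace (I' - I) with ((I' - J) - (I - J)) by ring.
  apply Rle_lt_trans with (1 := Rabs_triang _ _). rewrite Rabs_Ropp. lra.
Qed.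

(* Uniform boundedness for a family of seminorms, by nested balls on the [n]-th of
   which some member of the family is at least [n]. *)
Lemma uniform_boundedness {X : CompleteNormedModule R_AbsRing} {I : Type} (N : I -> X -> R) :
  (forall i x y, N i (plus x y) <= N i x + N i y) ->
  (forall i k x, N i (scal k x) <= Rabs k * N i x) ->
  (forall i, exists M, forall x, N i x <= M * norm x) ->
  (forall x, exists B, forall i, N i x <= B) ->
  exists M, forall i x, N i x <= M * norm x.
Proof.
intros Htri Hscal Hcont Hbnd. apply NNPP. intros Hno.
assert (Hdist : forall a b c : X, norm (minus a c) <= norm (minus a b) + norm (minus b c)).
{ intros a b c. replace (minus a c) with (plus (minus a b) (minus b c)) by module_ring X.
  apply (norm_triangle (V := X)). }
assert (Hsym : forall a b : X, norm (minus a b) = norm (minus b a)).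
{ intros a b. rewrite <- (norm_opp (minus b a)). f_equal. module_ring X. }
assert (Hsub : forall i x y, N i (minus x y) <= N i x + N i y).
{ intros i x y. replace (minus x y) with (plus x (scal (-1) y)) by module_ring X.
  apply Rle_trans with (1 := Htri _ _ _). apply Rplus_le_compat_l.
  apply Rle_trans with (1 := Hscal _ _ _). rewrite Rabs_m1. lra. }
assert (Hscal' : forall i k x, 0 < k -> k * N i x <= N i (scal k x)).
{ intros i k x Hk.
  replace x with (scal (/ k) (scal k x)) at 1 by (module_ring X; field; lra).
  apply Rle_trans with (k * (Rabs (/ k) * N i (scal k x))).
  - apply Rmult_le_compat_l; [lra | apply Hscal].
  - assert (0 < / k) by now apply Rinv_0_lt_compat.
    rewrite Rabs_pos_eq by lra. right. field. lra. }
(* [p] is a ball (centre, radius) with a level n; [q] is a ball inside it, of at most half the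
   radius, on which one seminorm is at least n. *)
assert (Hstep : forall p : (X * R) * nat, exists q : X * R, 0 < snd (fst p) ->
  0 < snd q <= snd (fst p) / 2 /\
  norm (minus (fst q) (fst (fst p))) <= snd (fst p) / 2 /\
  exists i, forall y, norm (minus y (fst q)) <= snd q -> INR (snd p) <= N i y).
{ intros [[x r] n]. simpl.
  destruct (Rlt_dec 0 r) as [Hr | Hr]; [|now exists (x, r)].
  (* The factor is such that the multiple of z of norm r/2 has seminorm above n + 1. *)
  assert (Hz : exists i z, (INR n + 1) * 2 / r * norm z < N i z).
  { apply NNPP. intros H. apply Hno. exists ((INR n + 1) * 2 / r). intros i z.
    apply Rnot_lt_le. intros Hlt. apply H. now exists i, z. }
  destruct Hz as (i & z & Hz).
  destruct (Hcont i) as [M HM].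
  assert (Hnz : 0 < norm z).
  { destruct (norm_ge_0 z) as [H | H]; [easy|]. exfalso.
    specialize (HM z). rewrite <- H in HM, Hz. lra. }
  pose (z' := scal (r / 2 / norm z) z).
  assert (Hk : 0 < r / 2 / norm z) by (apply Rdiv_lt_0_compat; lra).
  assert (Hz'n : norm z' <= r / 2).
  { unfold z'. apply Rle_trans with (1 := norm_scal (V := X) (r / 2 / norm z) z).
    change (abs (r / 2 / norm z)) with (Rabs (r / 2 / norm z)).
    rewrite Rabs_pos_eq by lra. right. field. lra. }
  assert (Hz'N : INR n + 1 < N i z').
  { unfold z'. apply Rlt_le_trans with (2 := Hscal' i _ z Hk).
    apply (Rmult_lt_compat_l (r / 2 / norm z)) in Hz; [|easy].
    replace (r / 2 / norm z * ((INR n + 1) * 2 / r * norm z)) with (INR n + 1) in Hz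
      by (field; lra). easy. }
  (* On a ball of radius 1/(|M|+1) the seminorm falls by at most 1, from n + 1 at the centre to
     n. *)
  pose (r' := Rmin (r / 2) (/ (Rabs M + 1))).
  assert (HM1 : 0 < / (Rabs M + 1))
    by (apply Rinv_0_lt_compat; generalize (Rabs_pos M); lra).
  assert (Hr' : 0 < r') by (apply Rmin_glb_lt; lra).
  assert (Hball : forall x' y, INR n + 1 <= N i x' -> norm (minus y x') <= r' ->
    INR n <= N i y).
  { intros x' y Hx' Hy.
    assert (H1 : N i x' <= N i y + N i (minus y x')).
    { replace x' with (minus y (minus y x')) at 1; [apply Hsub|].
      module_ring X. }
    assert (H2 : N i (minus y x') <= 1).
    { apply Rle_trans with (1 := HM _).
      apply Rle_trans with ((Rabs M + 1) * r').
      - apply Rle_trans with ((Rabs M + 1) * norm (minus y x')).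
        + apply Rmult_le_compat_r; [apply norm_ge_0 | generalize (Rle_abs M); lra].
        + apply Rmult_le_compat_l; [generalize (Rabs_pos M); lra | easy].
      - apply Rle_trans with ((Rabs M + 1) * / (Rabs M + 1)).
        + apply Rmult_le_compat_l; [generalize (Rabs_pos M); lra | apply Rmin_r].
        + right. apply Rinv_r. generalize (Rabs_pos M). lra. }
    lra. }
  (* Since 2z' = (x+z') - (x-z'), the seminorm is at least n + 1 at one of the points x+z' and x-z',
     whatever its value at x; that point becomes the new centre. *)
  assert (Hsum : 2 * N i z' <= N i (plus x z') + N i (minus x z')).
  { apply Rle_trans with (1 := Hscal' i 2 z' ltac:(lra)).
    apply Rle_trans with (N i (minus (plus x z') (minus x z'))); [|apply Hsub].
    right. f_equal. module_ring X. }
  assert (Hx' : exists x', norm (minus x' x) <= r / 2 /\ INR n + 1 <= N i x').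
  { destruct (Rle_lt_dec (INR n + 1) (N i (plus x z'))) as [H | H].
    - exists (plus x z'). split; [|easy].
      replace (minus (plus x z') x) with z' by module_ring X. easy.
    - exists (minus x z'). split; [|lra].
      replace (minus (minus x z') x) with (opp z') by module_ring X.
      apply Rle_trans with (norm z'); [right; apply (norm_opp (V := X)) | easy]. }
  destruct Hx' as (x' & Hx1 & Hx2).
  exists (x', r'). intros _. simpl. split; [split; [easy | apply Rmin_l]|].
  split; [easy|]. exists i. intros y Hy. now apply Hball with x'. }
apply choice in Hstep. destruct Hstep as [step Hs].
pose (st := fix st n : X * R := match n with
  | O => (zero, 1)
  | S m => step (st m, m)
  end).
assert (Hr : forall n, 0 < snd (st n) <= / (INR n + 1)).
{ induction n as [|n [IH1 IH2]]; [simpl; rewrite Rplus_0_l, Rinv_1; lra|].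
  destruct (Hs (st n, n) IH1) as ((H1 & H2) & _).
  change (step (st n, n)) with (st (S n)) in H1, H2. simpl fst in H2.
  split; [easy|]. apply Rle_trans with (1 := H2).
  assert (Hn := pos_INR n). rewrite S_INR.
  apply Rle_trans with (/ (INR n + 1) / 2); [lra|].
  unfold Rdiv. rewrite <- Rinv_mult. apply Rinv_le_contravar; lra. }
assert (Hnest : forall n j, norm (minus (fst (st (j + n)%nat)) (fst (st n))) + snd (st (j + n)%nat)
  <= snd (st n)).
{ intros n. induction j as [|j IH].
  - simpl (0 + n)%nat. assert (H0 : norm (minus (fst (st n)) (fst (st n))) = 0).
    { transitivity (norm (zero : X)); [f_equal; module_ring X | exact (norm_zero (V := X))]. }
    rewrite H0. lra.
  - destruct (Hs (st (j + n)%nat, (j + n)%nat) (proj1 (Hr _))) as ((_ & H2) & H3 & _).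
    change (step (st (j + n)%nat, (j + n)%nat)) with (st (S j + n)%nat) in H2, H3.
    change (fst (st (j + n)%nat, (j + n)%nat)) with (st (j + n)%nat) in H2, H3.
    generalize (Hdist (fst (st (S j + n)%nat)) (fst (st (j + n)%nat)) (fst (st n))). lra. }
destruct (proj1 (filterlim_locally_cauchy (U := X) (F := eventually)
  (fun n => fst (st n)))) as [l Hl].
{ intros eps. assert (He := cond_pos eps).
  destruct (nat_large (/ (eps / 2))) as [n0 Hn0].
  assert (Hsm : snd (st n0) < eps / 2).
  { apply Rle_lt_trans with (1 := proj2 (Hr n0)).
    rewrite <- (Rinv_inv (eps / 2)).
    assert (0 < / (eps / 2)) by (apply Rinv_0_lt_compat; lra).
    apply Rinv_lt_contravar; [apply Rmult_lt_0_compat|]; lra. }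
  exists (fun n => (n0 <= n)%nat). split; [now exists n0|].
  intros n m Hn Hm. apply (@norm_compat1 R_AbsRing X).
  generalize (Hnest n0 (n - n0)%nat) (Hnest n0 (m - n0)%nat).
  replace (n - n0 + n0)%nat with n by lia. replace (m - n0 + n0)%nat with m by lia.
  intros H1 H2. apply Rle_lt_trans with (1 := Hdist _ (fst (st n0)) _).
  rewrite (Hsym (fst (st n0))).
  generalize (proj1 (Hr n)) (proj1 (Hr m)). lra. }
destruct (Hbnd l) as [B HB].
destruct (nat_large B) as [n Hn].
destruct (Hs (st n, n) (proj1 (Hr n))) as (_ & _ & i & Hi).
change (step (st n, n)) with (st (S n)) in Hi. simpl snd in Hi at 2.
specialize (HB i). apply (Rlt_not_le _ _ Hn). apply Rle_trans with (2 := HB).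
(* The limit l lies in the (n+1)-st closed ball: otherwise it would keep a positive distance from
   it, and with it from all later centres. *)
apply Hi. apply Rnot_lt_le. intros Hlt.
assert (Hlt' : snd (st (S n)) < norm (minus l (fst (st (S n))))) by exact Hlt.
destruct (proj1 (filterlim_norm_le (X := X) eventually _ _) Hl
  ((norm (minus l (fst (st (S n)))) - snd (st (S n))) / 2) ltac:(lra)) as [m Hm].
assert (Hm' : norm (minus (fst (st (m + S n)%nat)) l)
  <= (norm (minus l (fst (st (S n)))) - snd (st (S n))) / 2)
  by exact (Hm (m + S n)%nat ltac:(lia)).
specialize (Hnest (S n) m).
generalize (Hdist l (fst (st (m + S n)%nat)) (fst (st (S n)))) (proj1 (Hr (m + S n)%nat)).
rewrite (Hsym l (fst (st (m + S n)%nat))). lra.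
Qed.

(** * The integrand *)

Section MildSolutions.

Context (C T Rad phi alpha gamma : R)
  (hC : 0 < C) (hphi : 0 <= phi) (halpha : 0 <= alpha) (hgamma : 1 < gamma)
  (hchi : phi + alpha / gamma < 1).

Notation rho t := (Rpower t (1 / gamma)).
Notation chi := (phi + alpha / gamma).
Notation beta := (1 - (phi + alpha / gamma)).

(** 1 - 1/gamma is the factor in [Rpower_gap] for the exponent 1/gamma; f receives a quarter of the
    excess index. *)
Definition gap_const : R := (1 - 1 / gamma) / 4.
(** One factor [C] from the parabolic estimate, one from the bound on f, and the power of the gap
    from delta^alpha. *)
Definition integrand_const : R := C * C / Rpower gap_const alpha.
(** The factor 2/beta comes from integrating the two powers in the majorant, see
    [RInt_Rpower_majorant_le]. *)
Definition int_const : R := integrand_const * (2 / beta).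

Lemma inv_gamma_bounds : 0 < 1 / gamma < 1.
Proof.
split; [apply Rdiv_lt_0_compat; lra|].
apply (Rmult_lt_reg_r gamma); [lra|]. field_simplify; lra.
Qed.

Lemma chi_nonneg : 0 <= chi.
Proof.
assert (0 <= alpha / gamma)
  by (apply Rmult_le_pos; [easy | left; apply Rinv_0_lt_compat; lra]).
lra.
Qed.

Lemma integrand_const_pos : 0 < integrand_const.
Proof. apply Rdiv_lt_0_compat; [nra | apply Rpower_pos]. Qed.

Lemma int_const_pos : 0 < int_const.
Proof.
apply Rmult_lt_0_compat; [apply integrand_const_pos | apply Rdiv_lt_0_compat; lra].
Qed.

Lemma rho_lt (s t : R) : 0 < s < t -> rho s < rho t.
Proof. apply Rlt_Rpower_l, inv_gamma_bounds. Qed.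

(* The indices for which [f] maps [E_(sigma+delta)] to [G_sigma] at time [xi] and
   [S^(t-xi)] maps [G_sigma] to [E_(rho t)].  They exist because
   [rho xi + rho (t - xi) > rho t], and the loss [delta] is comparable to
   the distance of [xi] to the ends of [(0,t)], to the power [1/gamma]. *)
Lemma index_split (t xi : R) : 0 < xi < t -> exists sigma delta delta',
  0 < sigma /\ 0 < delta /\ sigma + delta < rho xi /\
  0 < delta' < rho (t - xi) /\ rho t <= sigma + delta' /\
  gap_const * rho (Rmin xi (t - xi)) <= delta.
Proof.
intros Hxi.
assert (Hp := inv_gamma_bounds).
assert (Hg : (1 - 1 / gamma) * rho (Rmin xi (t - xi)) <= rho xi + rho (t - xi) - rho t).
{ destruct (Rle_dec xi (t - xi)) as [H | H].
  - rewrite Rmin_left by easy.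
    generalize (Rpower_gap (1 / gamma) xi (t - xi) ltac:(lra) ltac:(lra)).
    now replace (xi + (t - xi)) with t by ring.
  - rewrite Rmin_right by lra.
    generalize (Rpower_gap (1 / gamma) (t - xi) xi ltac:(lra) ltac:(lra)).
    replace (t - xi + xi) with t by ring. lra. }
generalize (rho_lt xi t ltac:(lra)) (rho_lt (t - xi) t ltac:(lra)).
generalize (Rpower_pos xi (1 / gamma)) (Rpower_pos (t - xi) (1 / gamma)).
generalize (Rpower_pos (Rmin xi (t - xi)) (1 / gamma)).
unfold gap_const.
set (m := rho (Rmin xi (t - xi))) in *. set (q := rho xi) in *. set (r := rho (t - xi)) in *.
intros Hm Hq Hr H1 H2.
assert (Hpos : 0 < (1 - 1 / gamma) * m) by (apply Rmult_lt_0_compat; lra).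
(* With e the excess q + r - rho t: e/4 is the loss delta, e/4 separates sigma + delta from q, e/4
   separates delta' from r, and e/4 remains in sigma + delta' above rho t. *)
exists (q - (q + r - rho t) / 2), ((q + r - rho t) / 4), (r - (q + r - rho t) / 4).
repeat split; lra.
Qed.

Context {V : ModuleSpace R_Ring} (E G : scale V) (Sg f : R -> V -> V)
  (hEG : scale_incl E G) (hcpt : compact_embeddings E) (hmon : norm_monotone E)
  (hS : strongly_continuous_semigroup C E G Sg)
  (hpar : parabolic C T phi gamma E G Sg)
  (hfc : nonlinearity_continuous T Rad E G f)
  (hfb : nonlinearity_bounded C T Rad alpha gamma E G f).

(** * The semigroup and the integrand: estimates and continuity *)

Lemma semigroup_plus s t v w : 0 < s -> 0 < t -> mem G s v -> mem G s w ->
  Sg t (plus v w) = plus (Sg t v) (Sg t w).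
Proof.
intros Hs Ht [x <-] [y <-]. destruct hS as (_ & HL & _). now apply (HL t Ht s Hs).
Qed.

Lemma semigroup_scal s t k v : 0 < s -> 0 < t -> mem G s v -> Sg t (scal k v) = scal k (Sg t v).
Proof. intros Hs Ht [x <-]. destruct hS as (_ & HL & _). now apply (HL t Ht s Hs). Qed.

Lemma semigroup_minus s t v w : 0 < s -> 0 < t -> mem G s v -> mem G s w ->
  Sg t (minus v w) = minus (Sg t v) (Sg t w).
Proof.
intros Hs Ht Hv Hw. replace (minus v w) with (plus v (scal (-1) w)) by module_ring V.
rewrite (semigroup_plus s), (semigroup_scal s); try easy; [|now apply mem_scal].
module_ring V.
Qed.

Lemma semigroup_add s t r v : 0 < s -> 0 < t -> 0 < r -> mem G s v ->
  Sg (t + r) v = Sg t (Sg r v).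
Proof. intros Hs Ht Hr [x <-]. destruct hS as (_ & _ & HA & _). now apply (HA s). Qed.

Lemma semigroup_mem s t v : 0 < s -> 0 < t -> mem G s v -> mem E s (Sg t v).
Proof. intros Hs Ht [x <-]. destruct hS as (HM & _). now apply HM. Qed.

Lemma semigroup_bounded s t r v : 0 < s -> 0 < t -> cball E s r v -> cball E s (C * r) (Sg t v).
Proof.
intros Hs Ht (x & <- & Hx). destruct hS as (_ & _ & _ & _ & HB).
apply cball_le with (2 := HB s t Hs Ht x). apply Rmult_le_compat_l; [lra | easy].
Qed.

Lemma semigroup_continuous_0 s v eps : 0 < s -> mem E s v -> 0 < eps ->
  exists d, 0 < d /\ forall t, 0 < t < d -> cball E s eps (minus (Sg t v) v).
Proof.
intros Hs [x <-] He. destruct hS as (_ & _ & _ & HC & _).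
now apply at_right_0, (HC s Hs x (mkposreal eps He)).
Qed.

Lemma semigroup_zero t : 0 < t -> Sg t zero = zero.
Proof.
intros Ht.
assert (H0 : mem G 1 zero) by (exists zero; apply emb_zero; lra).
transitivity (Sg t (scal 0 zero)); [f_equal; module_ring V|].
rewrite (semigroup_scal 1); try easy; try lra. module_ring V.
Qed.

(** From S^(r+h) v - S^r v = S^r (S^h v - v) and the bound [C] uniform in r: the radius does not
    depend on r, so taking r to be the smaller of t and a covers both sides. *)
Lemma semigroup_continuous s a v eps : 0 < s -> 0 < a -> mem E s v -> 0 < eps ->
  exists d, 0 < d /\ forall t, 0 < t -> Rabs (t - a) < d ->
    cball E s eps (minus (Sg t v) (Sg a v)).
Proof.
intros Hs Ha Hv He.
assert (HvG : mem G s v) by now apply hEG.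
destruct (semigroup_continuous_0 s v (eps / C) Hs Hv) as (d & Hd & H);
  [now apply Rdiv_lt_0_compat|].
assert (Hinc : forall r h, 0 < r -> 0 < h < d -> cball E s eps (minus (Sg (r + h) v) (Sg r v))).
{ intros r h Hr Hh.
  assert (HhG : mem G s (Sg h v)) by (apply (hEG s Hs), semigroup_mem; easy || lra).
  rewrite (semigroup_add s), <- (semigroup_minus s) by (easy || lra).
  replace eps with (C * (eps / C)) by (field; lra).
  apply semigroup_bounded; [easy | easy | now apply H]. }
exists d. split; [easy|]. intros t Ht Hta. apply Rabs_def2 in Hta.
destruct (Rtotal_order t a) as [Hlt | [-> | Hlt]].
- apply cball_minus_sym; [easy|]. replace a with (t + (a - t)) by ring. apply Hinc; lra.
- replace (minus (Sg a v) (Sg a v)) with (@zero V) by module_ring V. apply cball_zero; lra.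
- replace t with (a + (t - a)) by ring. apply Hinc; lra.
Qed.

Lemma semigroup_gain s sigma delta t r v : 0 < s <= sigma + delta -> 0 < sigma ->
  0 < delta < rho t -> 0 < t < T -> cball G sigma r v ->
  cball E s (C / Rpower t phi * r) (Sg t v).
Proof.
intros Hs Hsigma Hdelta Ht (x & <- & Hx).
apply cball_nested with (sigma + delta); [easy | easy |].
apply cball_le with (C / Rpower t phi * norm x).
- apply Rmult_le_compat_l; [|easy]. left. apply Rdiv_lt_0_compat; [easy | apply Rpower_pos].
- apply hpar; try easy. split; [|easy]. apply Rpower_inv_lt; lra.
Qed.

(** Joint continuity in time and vector. Strong continuity is given on E_s, not on G_sigma; hence
    S^b is split off with b < tau0 still long enough to gain delta, and the remaining time acts on
    S^b y0 in E_s. The change of the vector is controlled by the parabolic bound, uniform for times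
    above b. *)
Lemma semigroup_tends {I : Type} (F : (I -> Prop) -> Prop) {FF : Filter F}
  (tau : I -> R) (y : I -> V) tau0 y0 s sigma delta :
  0 < s <= sigma + delta -> 0 < sigma -> 0 < delta < rho tau0 -> 0 < tau0 < T ->
  (forall d, 0 < d -> F (fun i => Rabs (tau i - tau0) < d)) ->
  mem G sigma y0 -> tends F G sigma y y0 ->
  tends F E s (fun i => Sg (tau i) (y i)) (Sg tau0 y0).
Proof.
intros Hs Hsigma Hdelta Htau0 Htau Hy0 Hy eps He.
assert (Hlt : Rpower delta gamma < tau0) by (apply Rpower_inv_lt; lra).
generalize (Rpower_pos delta gamma); intros Hdg.
pose (b := (Rpower delta gamma + tau0) / 2).
assert (Hb : Rpower delta gamma < b < tau0) by (unfold b; lra).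
assert (Hdb : delta < rho b) by (apply Rpower_inv_lt; lra).
assert (Hw : mem E s (Sg b y0)).
{ destruct (mem_cball _ _ _ Hy0) as (r & _ & Hr).
  apply cball_mem with (C / Rpower b phi * r), (semigroup_gain s sigma delta); easy || lra. }
destruct (semigroup_continuous s (tau0 - b) (Sg b y0) (eps / 2)) as (d & Hd & Hcont);
  try easy; try lra.
assert (Hbp := Rpower_pos b phi).
pose (r := eps / 2 * (Rpower b phi / C)).
assert (Hr : 0 < r) by (apply Rmult_lt_0_compat; [lra | now apply Rdiv_lt_0_compat]).
assert (Hd' : 0 < Rmin d (Rmin (tau0 - b) (T - tau0)))
  by (repeat apply Rmin_glb_lt; lra).
generalize (filter_and _ _ (Htau _ Hd') (Hy r Hr)). apply filter_imp.
intros i [Hti Hyi].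
assert (Hti1 := Rlt_le_trans _ _ _ Hti (Rmin_l _ _)).
assert (Hti2 := Rlt_le_trans _ _ _ Hti (Rle_trans _ _ _ (Rmin_r _ _) (Rmin_l _ _))).
assert (Hti3 := Rlt_le_trans _ _ _ Hti (Rle_trans _ _ _ (Rmin_r _ _) (Rmin_r _ _))).
apply Rabs_def2 in Hti2. apply Rabs_def2 in Hti3.
assert (HyG : mem G sigma (y i)).
{ replace (y i) with (plus (minus (y i) y0) y0) by module_ring V.
  apply mem_plus; [easy | exact (cball_mem _ _ _ _ Hyi) | easy]. }
replace eps with (eps / 2 + eps / 2) by field.
apply cball_triangle with (Sg (tau i) y0); [easy | |].
- rewrite <- (semigroup_minus sigma); try easy; try lra.
  apply cball_le with (C / Rpower (tau i) phi * r).
  + unfold r.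
    assert (Hle : Rpower b phi <= Rpower (tau i) phi) by (apply Rle_Rpower_l; lra).
    apply Rle_trans with (C / Rpower b phi * (eps / 2 * (Rpower b phi / C)));
      [|right; field; lra].
    apply Rmult_le_compat_r; [now left|]. unfold Rdiv. apply Rmult_le_compat_l; [lra|].
    now apply Rinv_le_contravar.
  + apply (semigroup_gain s sigma delta); try easy; try lra.
    split; [easy|]. apply Rlt_trans with (1 := Hdb). apply rho_lt. lra.
- replace (tau i) with ((tau i - b) + b) by ring.
  replace (Sg tau0 y0) with (Sg (tau0 - b + b) y0) by (f_equal; ring).
  rewrite !(semigroup_add sigma); try easy; try lra.
  apply Hcont; [lra|]. replace (tau i - b - (tau0 - b)) with (tau i - tau0) by ring. easy.
Qed.

(** The target scale is a parameter: [G] for the integral equation, [E] for the differential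
    equation. Continuity of f is relative to its domain, so the family is required to stay in the
    ball. *)
Lemma nonlinearity_tends {I : Type} (F : (I -> Prop) -> Prop) {FF : Filter F}
  (H : scale V) (xi : I -> R) (v : I -> V) xi0 v0 sigma delta :
  nonlinearity_continuous T Rad E H f -> 0 < sigma -> 0 < delta -> 0 < xi0 < T ->
  (forall d, 0 < d -> F (fun i => Rabs (xi i - xi0) < d)) ->
  cball E (sigma + delta) Rad v0 -> F (fun i => cball E (sigma + delta) Rad (v i)) ->
  tends F E (sigma + delta) v v0 ->
  mem H sigma (f xi0 v0) /\ tends F H sigma (fun i => f (xi i) (v i)) (f xi0 v0).
Proof.
intros HfH Hsigma Hdelta Hxi0 Hxi Hv0 Hv Htv.
assert (Hs : 0 < sigma + delta) by lra.
destruct (HfH sigma delta Hsigma Hdelta) as (Fm & HF & Hcont). cbv zeta in HF, Hcont.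
assert (HD : forall t w, 0 < t <= T -> cball E (sigma + delta) Rad w ->
  emb (Fm (t, lift E (sigma + delta) w)) = f t w).
{ intros t w Ht Hw. apply cball_lift in Hw; [|easy]. destruct Hw as [Hm Hn].
  rewrite HF; simpl; [now rewrite emb_lift | easy]. }
split.
- rewrite <- HD by (easy || lra). now eexists.
- intros eps He.
  pose (p0 := (xi0, lift E (sigma + delta) v0)).
  pose (pr := fun i => (xi i, lift E (sigma + delta) (v i))).
  assert (Hpr : filterlim pr F (locally p0)).
  { apply filterlim_locally. intros e.
    assert (H2 : tends F E (sigma + delta) v v0) by easy.
    apply tends_lift in H2; [|easy|easy|exact (cball_mem _ _ _ _ Hv0)].
    assert (H3 := proj1 (filterlim_locally (U := E (sigma + delta)) _ _) H2 e).
    generalize (filter_and _ _ (Hxi e (cond_pos e)) H3). apply filter_imp.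
    intros i [Hi1 Hi2]. split; [exact Hi1 | exact Hi2]. }
  assert (Hp0 : 0 < fst p0 <= T /\ norm (snd p0) <= Rad)
    by (split; [simpl; lra | now apply cball_lift]).
  assert (Hlim := proj1 (filterlim_norm_le (X := H sigma) _ _ _) (Hcont p0 Hp0) eps He).
  unfold within in Hlim.
  assert (Hd : 0 < Rmin xi0 (T - xi0)) by (apply Rmin_glb_lt; lra).
  assert (HFlim : F (fun i => 0 < fst (pr i) <= T /\ norm (snd (pr i)) <= Rad ->
    norm (minus (Fm (pr i)) (Fm p0)) <= eps)) by exact (Hpr _ Hlim).
  generalize (filter_and _ _ HFlim (filter_and _ _ Hv (Hxi _ Hd))).
  apply filter_imp. intros i (Hi1 & Hi2 & Hi3).
  assert (Ht : 0 < xi i <= T).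
  { generalize (Rmin_l xi0 (T - xi0)) (Rmin_r xi0 (T - xi0)).
    apply Rabs_def2 in Hi3. lra. }
  rewrite <- !HD; try easy; try lra.
  rewrite <- emb_minus by easy. exists (minus (Fm (pr i)) (Fm p0)). split; [easy|]. apply Hi1.
  split; [easy|]. now apply cball_lift.
Qed.

Definition admissible (t : R) (v : V) : Prop := forall s, 0 < s < rho t -> cball E s Rad v.

(** With m = min(xi, t-xi), the parabolic estimate costs at most m^(-phi), and f costs
    delta^(-alpha) with delta >= [gap_const] m^(1/gamma). The product is of order m^(-chi), which is
    one of the two summands of the majorant. *)
Lemma integrand_bound t xi v : 0 < xi < t -> t <= T -> admissible xi v ->
  cball E (rho t) (integrand_const * (Rpower xi (- chi) + Rpower (t - xi) (- chi)))
    (Sg (t - xi) (f xi v)).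
Proof.
intros Hxi Ht Hv.
destruct (index_split t xi Hxi) as (sigma & delta & delta' &
  Hsigma & Hdelta & Hlt & Hd' & Hge & Hgap).
assert (Hf : cball G sigma (C / Rpower delta alpha) (f xi v)).
{ apply hfb; try easy; [|apply Hv; lra].
  split; [apply Rpower_inv_lt; lra | lra]. }
assert (HS := semigroup_gain (rho t) sigma delta' (t - xi) _ _
  (conj (Rpower_pos _ _) Hge) Hsigma Hd' ltac:(lra) Hf).
apply cball_le with (2 := HS).
set (m := Rmin xi (t - xi)) in *.
assert (Hm : 0 < m) by (apply Rmin_glb_lt; lra).
assert (Hgc : 0 < gap_const) by (generalize inv_gamma_bounds; unfold gap_const; lra).
apply Rle_trans with (integrand_const * Rpower m (- chi)).
- unfold integrand_const.
  replace (C * C / Rpower gap_const alpha * Rpower m (- chi))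
    with (C * / Rpower m phi * (C * / (Rpower gap_const alpha * Rpower (rho m) alpha))).
  + assert (H1 : Rpower m phi <= Rpower (t - xi) phi)
      by (apply Rle_Rpower_l; [easy | split; [easy | apply Rmin_r]]).
    assert (H2 : Rpower gap_const alpha * Rpower (rho m) alpha <= Rpower delta alpha).
    { rewrite Rpower_mult_distr by (easy || apply Rpower_pos).
      apply Rle_Rpower_l; [easy|]. split; [|easy].
      apply Rmult_lt_0_compat; [easy | apply Rpower_pos]. }
    assert (H3 := Rpower_pos m phi). assert (H4 := Rpower_pos gap_const alpha).
    assert (H5 := Rpower_pos (rho m) alpha).
    apply Rinv_le_contravar in H1; [|easy].
    apply Rinv_le_contravar in H2; [|now apply Rmult_lt_0_compat].
    unfold Rdiv. apply Rmult_le_compat.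
    * apply Rmult_le_pos; [lra | left; apply Rinv_0_lt_compat, Rpower_pos].
    * apply Rmult_le_pos; [lra | left; apply Rinv_0_lt_compat, Rpower_pos].
    * apply Rmult_le_compat_l; [lra | easy].
    * apply Rmult_le_compat_l; [lra | easy].
  + rewrite Rpower_mult, Rpower_Ropp, Rpower_plus.
    replace (1 / gamma * alpha) with (alpha / gamma) by (field; lra).
    field. repeat split; apply Rgt_not_eq, Rpower_pos.
- apply Rmult_le_compat_l; [left; apply integrand_const_pos|].
  generalize (Rpower_pos xi (- chi)) (Rpower_pos (t - xi) (- chi)).
  unfold m, Rmin. destruct (Rle_dec xi (t - xi)); lra.
Qed.

(** Stated for an arbitrary filter so as to give both continuity in xi and joint convergence in xi
    and the number of an approximation. *)
Lemma integrand_tends {I : Type} (F : (I -> Prop) -> Prop) {FF : Filter F}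
  (xi : I -> R) (v : I -> V) t xi0 v0 :
  0 < xi0 < t -> t <= T ->
  (forall d, 0 < d -> F (fun i => Rabs (xi i - xi0) < d)) ->
  admissible xi0 v0 ->
  (forall s, 0 < s < rho xi0 -> F (fun i => cball E s Rad (v i)) /\ tends F E s v v0) ->
  tends F E (rho t) (fun i => Sg (t - xi i) (f (xi i) (v i))) (Sg (t - xi0) (f xi0 v0)).
Proof.
intros Hxi0 Ht Hxi Hv0 Hv.
destruct (index_split t xi0 Hxi0) as (sigma & delta & delta' &
  Hsigma & Hdelta & Hlt & Hd' & Hge & _).
destruct (Hv (sigma + delta) ltac:(lra)) as [Hv1 Hv2].
destruct (nonlinearity_tends F G xi v xi0 v0 sigma delta) as [Hm Hf]; try easy; try lra.
{ apply Hv0. lra. }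
apply (semigroup_tends F (fun i => t - xi i) _ (t - xi0) (f xi0 v0) (rho t) sigma delta');
  try easy; try lra.
- split; [apply Rpower_pos | easy].
- intros d Hd. generalize (Hxi d Hd). apply filter_imp. intros i Hi.
  replace (t - xi i - (t - xi0)) with (- (xi i - xi0)) by ring. now rewrite Rabs_Ropp.
Qed.

Lemma bounded_extract s s' M (v : nat -> V) : 0 < s < s' -> (forall n, cball E s' M (v n)) ->
  exists k l, str_inc k /\ mem E s l /\ tends eventually E s (fun n => v (k n)) l.
Proof.
intros Hs Hv. replace s' with (s + (s' - s)) in Hv by ring.
apply choice in Hv. destruct Hv as [x Hx].
destruct (hcpt s (s' - s) ltac:(lra) ltac:(lra) x M) as (k & y & l & Hk & Hy & Hl);
  [intros n; apply Hx|].
exists k, (emb l). split; [easy|]. split; [now exists l|]. intros eps He.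
generalize (proj1 (filterlim_norm_le (X := E s) eventually _ _) Hl eps He).
apply filter_imp. intros n Hn. rewrite <- (proj1 (Hx (k n))), <- Hy, <- emb_minus by lra.
now exists (minus (y n) l).
Qed.

(* By compactness of [E_s' -> E_s], strong continuity is uniform on bounded
   subsets of [E_s']. *)
Lemma semigroup_uniformly_continuous_0 s s' M eps : 0 < s < s' -> 0 < eps ->
  exists d, 0 < d /\ forall h v, 0 < h < d -> cball E s' M v -> cball E s eps (minus (Sg h v) v).
Proof.
intros Hs He. apply NNPP. intros Hno.
assert (Hbad : forall n : nat, exists hv : R * V, 0 < fst hv < / (INR n + 1) /\
  cball E s' M (snd hv) /\ ~ cball E s eps (minus (Sg (fst hv) (snd hv)) (snd hv))).
{ intros n. apply NNPP. intros H. apply Hno. exists (/ (INR n + 1)).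
  split; [apply Rinv_0_lt_compat; generalize (pos_INR n); lra|].
  intros h v Hh Hx. apply NNPP. intros Hv. apply H. now exists (h, v). }
apply choice in Hbad. destruct Hbad as [hv Hhv].
destruct (bounded_extract s s' M (fun n => snd (hv n)) Hs) as (k & l & Hk & Hlm & Hl);
  [intros n; apply Hhv|].
destruct (semigroup_continuous_0 s l (eps / 2)) as (d & Hd & Hcont); try easy; try lra.
assert (HlG : mem G s l) by (apply hEG; easy || lra).
destruct (Hl (eps / 2 / (C + 1))) as [N HN].
{ apply Rdiv_lt_0_compat; lra. }
destruct (nat_large (/ d)) as [N' HN'].
pose (n := max N N').
destruct (Hhv (k n)) as ((Hh0 & Hh1) & _ & Hn). apply Hn.
assert (Hh : fst (hv (k n)) < d).
{ apply Rlt_trans with (1 := Hh1). rewrite <- (Rinv_inv d).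
  assert (Hdi := Rinv_0_lt_compat d Hd).
  assert (Hle : INR N' <= INR (k n)).
  { apply le_INR. generalize (str_inc_ge k Hk n). unfold n. lia. }
  apply Rinv_lt_contravar; [apply Rmult_lt_0_compat|]; lra. }
assert (Hyl : cball E s (eps / 2 / (C + 1)) (minus (snd (hv (k n))) l))
  by (apply HN; unfold n; lia).
set (h := fst (hv (k n))) in *. set (y := snd (hv (k n))) in *.
(* (S^h - 1) y is split at the limit l: the part of y - l is small uniformly in h by the bound C +
   1, the part of l by strong continuity at one vector. *)
replace (minus (Sg h y) y) with
  (plus (minus (Sg h (minus y l)) (minus y l)) (minus (Sg h l) l)).
- replace eps with (C * (eps / 2 / (C + 1)) + eps / 2 / (C + 1) + eps / 2) by (field; lra).
  apply cball_plus; [lra | | apply Hcont; lra].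
  apply cball_minus; [lra | apply semigroup_bounded; easy || lra | easy].
- assert (Hy : mem G s y).
  { apply hEG; [lra|]. replace y with (plus (minus y l) l) by module_ring V.
    apply mem_plus; [lra | exact (cball_mem _ _ _ _ Hyl) | easy]. }
  rewrite (semigroup_minus s) by (easy || lra). module_ring V.
Qed.

(** * The solution class and its equicontinuity *)

Context (Tstar : R) (hTstar : 0 < Tstar <= T)
  (hRad : forall t, 0 < t < Tstar -> int_const * Rpower t beta <= Rad).

(* The class of functions in which the solution is sought.  It contains the
   approximate solutions and is compact for locally uniform convergence. *)
Definition good (u : R -> V) : Prop :=
  (forall t s, 0 < t < Tstar -> 0 < s < rho t -> cball E s (int_const * Rpower t beta) (u t)) /\
  (forall t t' s, 0 < t < t' -> t' < Tstar -> 0 < s < rho t ->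
     cball E s (int_const * Rpower (t' - t) beta) (minus (u t') (Sg (t' - t) (u t)))).

Lemma good_admissible u t : good u -> 0 < t < Tstar -> admissible t (u t).
Proof. intros [H _] Ht s Hs. apply cball_le with (2 := H t s Ht Hs). now apply hRad. Qed.

(** Makes room on two sides: an index above s to pay for compactness, available also at times
    slightly before t0. *)
Lemma rho_index_before t0 s : 0 < t0 -> 0 < s < rho t0 ->
  exists s' t1, s < s' /\ 0 < t1 < t0 /\ s' < rho t1.
Proof.
intros Ht0 Hs.
pose (s' := (s + rho t0) / 2).
assert (Hs' : s < s' < rho t0) by (unfold s'; lra).
assert (Hlt : Rpower s' gamma < t0) by (apply Rpower_inv_lt; lra).
assert (Hp := Rpower_pos s' gamma).
exists s', ((Rpower s' gamma + t0) / 2). repeat split; try lra.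
apply Rpower_inv_lt; lra.
Qed.

(** The radius is chosen before the function. An increment is taken from the earlier time and split
    as (u(t') - S^(t'-t) u(t)) + (S^(t'-t) - 1) u(t); the class bounds the first part, uniform
    strong continuity on a ball of higher index the second. *)
Lemma good_equicontinuous t0 s eps : 0 < t0 < Tstar -> 0 < s < rho t0 -> 0 < eps ->
  exists d, 0 < d /\ forall u t, good u -> Rabs (t - t0) < d ->
    0 < t < Tstar /\ s < rho t /\ cball E s eps (minus (u t) (u t0)).
Proof.
intros Ht0 Hs He.
destruct (rho_index_before t0 s) as (s' & t1 & Hs' & Ht1 & Hst1); try lra.
destruct (semigroup_uniformly_continuous_0 s s' Rad (eps / 2)) as (d1 & Hd1 & HS); try lra.
destruct (Rpower_small int_const beta (eps / 2)) as (d2 & Hd2 & HK); try lra.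
assert (Hinc : forall u t t', good u -> t1 < t < t' -> t' < Tstar -> t' - t < d1 ->
  t' - t < d2 -> cball E s eps (minus (u t') (u t))).
{ intros u t t' Hu Ht Ht' Hl1 Hl2.
  assert (Hrt : rho t1 < rho t) by (apply rho_lt; lra).
  replace eps with (eps / 2 + eps / 2) by field.
  apply cball_triangle with (Sg (t' - t) (u t)); [easy | |].
  - apply cball_le with (int_const * Rpower (t' - t) beta); [apply HK; lra|].
    apply (proj2 Hu); lra.
  - apply HS; [lra|]. apply good_admissible; [easy | lra | lra]. }
exists (Rmin (Rmin d1 d2) (Rmin (t0 - t1) (Tstar - t0))).
split; [repeat apply Rmin_glb_lt; lra|].
intros u t Hu Ht.
generalize (Rmin_l (Rmin d1 d2) (Rmin (t0 - t1) (Tstar - t0)))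
  (Rmin_r (Rmin d1 d2) (Rmin (t0 - t1) (Tstar - t0)))
  (Rmin_l d1 d2) (Rmin_r d1 d2) (Rmin_l (t0 - t1) (Tstar - t0)) (Rmin_r (t0 - t1) (Tstar - t0)).
apply Rabs_def2 in Ht. intros.
split; [lra|]. split; [apply Rlt_trans with (rho t1); [lra | apply rho_lt; lra]|].
destruct (Rtotal_order t t0) as [Hlt | [-> | Hlt]].
- apply cball_minus_sym; [easy|]. apply Hinc; easy || lra.
- replace (minus (u t0) (u t0)) with (@zero V) by module_ring V. apply cball_zero; lra.
- apply Hinc; easy || lra.
Qed.

(** * The integral equation *)

Definition integrand (u : R -> V) (t xi : R) : V := Sg (t - xi) (f xi (u xi)).

(** The Duhamel integral truncated to [a,b], formed at the largest index for which the integrand is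
    estimated; smaller indices follow by [seg_int_nested]. *)
Definition duhamel (u : R -> V) (t a b : R) : V :=
  emb (RInt (fun xi => lift E (rho t) (integrand u t xi)) a b).

Lemma rho_pos t : 0 < rho t.
Proof. apply Rpower_pos. Qed.

Lemma good_locally u t s : good u -> 0 < t < Tstar -> 0 < s < rho t ->
  locally t (fun r => cball E s Rad (u r)) /\ tends (locally t) E s u (u t).
Proof.
intros Hu Ht Hs.
assert (HE : forall eps, 0 < eps ->
  locally t (fun r => cball E s Rad (u r) /\ cball E s eps (minus (u r) (u t)))).
{ intros eps He.
  destruct (good_equicontinuous t s eps Ht Hs He) as (d & Hd & H).
  apply locally_R. exists d. split; [easy|]. intros r Hr.
  destruct (H u r Hu Hr) as (Hr1 & Hr2 & Hr3). split; [|easy].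
  apply good_admissible; [easy | easy | lra]. }
split.
- generalize (HE 1 Rlt_0_1). now apply filter_imp.
- intros eps He. generalize (HE eps He). now apply filter_imp.
Qed.

Lemma good_integrand_tends u t xi : good u -> 0 < xi < t -> t < Tstar ->
  tends (locally xi) E (rho t) (integrand u t) (integrand u t xi).
Proof.
intros Hu Hxi Ht.
apply (integrand_tends (locally xi) (fun x => x) u t xi (u xi)); try easy; try lra.
- intros d Hd. apply locally_R. now exists d.
- apply good_admissible; easy || lra.
- intros s Hs. apply good_locally; easy || lra.
Qed.

Lemma good_integrand_bound u t xi : good u -> 0 < xi < t -> t < Tstar ->
  cball E (rho t) (integrand_const * (Rpower xi (- chi) + Rpower (t - xi) (- chi)))
    (integrand u t xi).
Proof.
intros Hu Hxi Ht. apply integrand_bound; [easy | lra |]. apply good_admissible; easy || lra.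
Qed.

Lemma duhamel_seg_int u t a b : good u -> 0 < a <= b -> b < t -> t < Tstar ->
  seg_int E (rho t) (integrand u t) a b (duhamel u t a b).
Proof.
intros Hu Hab Hb Ht. apply seg_int_exists; [apply rho_pos | easy |].
intros x Hx. split.
- eapply cball_mem, good_integrand_bound; easy || lra.
- apply good_integrand_tends; easy || lra.
Qed.

(** Depending on b - a only, this one estimate serves for the size of u, for its increments and for
    the discarded end pieces. *)
Lemma duhamel_bound u t a b : good u -> 0 < a <= b -> b < t -> t < Tstar ->
  cball E (rho t) (int_const * Rpower (b - a) beta) (duhamel u t a b).
Proof.
intros Hu Hab Hb Ht.
assert (Hchi := chi_nonneg).
destruct (RInt_Rpower_majorant_le t chi a b) as (I & HI & Hle); try easy.
apply cball_le with (integrand_const * I).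
- unfold int_const. rewrite Rmult_assoc. apply Rmult_le_compat_l; [|easy].
  left. apply integrand_const_pos.
- apply (seg_int_norm E (rho t) (integrand u t)
    (fun xi => integrand_const * (Rpower xi (- chi) + Rpower (t - xi) (- chi))) a b).
  + apply rho_pos.
  + intros x Hx. apply good_integrand_bound; easy || lra.
  + exact (is_RInt_scal (V := R_NormedModule) _ _ _ integrand_const _ HI).
  + now apply duhamel_seg_int.
Qed.

Lemma duhamel_Chasles u t a b c : good u -> 0 < a <= b -> b <= c < t -> t < Tstar ->
  duhamel u t a c = plus (duhamel u t a b) (duhamel u t b c).
Proof.
intros Hu Hab Hbc Ht.
apply (seg_int_unique E (rho t) (integrand u t) a c); [apply duhamel_seg_int; easy || lra|].
apply seg_int_Chasles with b; [apply rho_pos | |]; apply duhamel_seg_int; easy || lra.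
Qed.

Lemma nonlinearity_mem t v : 0 < t <= T -> admissible t v ->
  exists s, 0 < s /\ mem G s (f t v).
Proof.
intros Ht Hv. assert (Hr := rho_pos t).
exists (rho t / 4). split; [lra|].
apply cball_mem with (C / Rpower (rho t / 4) alpha), hfb; try lra.
- split; [apply Rpower_inv_lt; lra | lra].
- apply Hv. lra.
Qed.

Lemma integrand_semigroup u t t' xi : good u -> 0 < xi < t -> t < t' -> t' < Tstar ->
  Sg (t' - t) (integrand u t xi) = integrand u t' xi.
Proof.
intros Hu Hxi Ht Ht'.
destruct (nonlinearity_mem xi (u xi)) as (s & Hs & Hm);
  [lra | apply good_admissible; easy || lra |].
unfold integrand. rewrite <- (semigroup_add s) by (easy || lra). f_equal. ring.
Qed.

(** The semigroup law under the integral sign. The two sides are formed in spaces of different index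
    and are compared in the larger space, that of index rho t. *)
Lemma duhamel_semigroup u t t' a b : good u -> 0 < a <= b -> b < t -> t < t' -> t' < Tstar ->
  Sg (t' - t) (duhamel u t a b) = duhamel u t' a b.
Proof.
intros Hu Hab Hb Ht Ht'.
assert (Hr := rho_pos t).
apply (seg_int_unique E (rho t) (integrand u t') a b).
- apply seg_int_ext with (fun xi => Sg (t' - t) (integrand u t xi)).
  { intros x Hx. apply integrand_semigroup; easy || lra. }
  apply (seg_int_op E E (rho t) (rho t) _ C); try easy.
  + intros v w Hv Hw. apply (semigroup_plus (rho t)); try lra; now apply hEG.
  + intros k v Hv. apply (semigroup_scal (rho t)); try lra; now apply hEG.
  + intros r v Hv. apply semigroup_bounded; easy || lra.
  + apply duhamel_seg_int; easy || lra.
- apply seg_int_nested with (rho t'); [easy | split; [easy | left; apply rho_lt; lra] |].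
  apply duhamel_seg_int; easy || lra.
Qed.

(* Tonelli's approximation: the value at [t] only involves [u] on [(0, t - h]]. *)
Definition delayed (h : R) (u : R -> V) (t : R) : V :=
  if Rlt_dec (2 * h) t then duhamel u t h (t - h) else zero.

Lemma Rpower_mono_scaled (x y : R) : 0 < x <= y ->
  int_const * Rpower x beta <= int_const * Rpower y beta.
Proof.
intros H. apply Rmult_le_compat_l; [left; apply int_const_pos|].
apply Rle_Rpower_l; [lra | easy].
Qed.

Lemma int_const_Rpower_nonneg (x : R) : 0 <= int_const * Rpower x beta.
Proof. apply Rmult_le_pos; left; [apply int_const_pos | apply Rpower_pos]. Qed.

Lemma zero_good : good (fun _ => zero).
Proof.
split.
- intros t s _ Hs. apply cball_zero; [easy | apply int_const_Rpower_nonneg].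
- intros t t' s Ht _ Hs. cbv beta. rewrite semigroup_zero by lra.
  apply cball_minus_zero.
  apply cball_zero; [easy | apply int_const_Rpower_nonneg].
Qed.

(** S^(t'-t) turns the integral for t into the initial part of the one for t'; what remains lies
    over (t-h, t'-h), of length t' - t. If t <= 2h the value at t is zero and the integral for t'
    has length t' - 2h <= t' - t. *)
Lemma delayed_good h u : 0 < h -> good u -> good (delayed h u).
Proof.
intros Hh Hu. split.
- intros t s Ht Hs. unfold delayed. destruct (Rlt_dec (2 * h) t) as [Hlt | Hge].
  + apply cball_nested with (rho t); [easy | lra |].
    apply cball_le with (int_const * Rpower (t - h - h) beta);
      [apply Rpower_mono_scaled; lra|].
    apply duhamel_bound; easy || lra.
  + apply cball_zero; [easy | apply int_const_Rpower_nonneg].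
- intros t t' s Ht Ht' Hs.
  assert (Hrt : rho t < rho t') by (apply rho_lt; lra).
  unfold delayed at 1. destruct (Rlt_dec (2 * h) t') as [Hlt' | Hge'];
  unfold delayed; destruct (Rlt_dec (2 * h) t) as [Hlt | Hge]; try lra.
  + rewrite duhamel_semigroup by (easy || lra).
    rewrite (duhamel_Chasles u t' h (t - h) (t' - h)) by (easy || lra).
    match goal with |- cball _ _ _ (minus (plus ?a ?b) ?a) =>
      replace (minus (plus a b) a) with b by module_ring V end.
    apply cball_nested with (rho t'); [easy | lra |].
    replace (t' - t) with (t' - h - (t - h)) by ring.
    apply duhamel_bound; easy || lra.
  + rewrite semigroup_zero by lra.
    apply cball_minus_zero.
    apply cball_nested with (rho t'); [easy | lra |].
    apply cball_le with (int_const * Rpower (t' - h - h) beta);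
      [apply Rpower_mono_scaled; lra|].
    apply duhamel_bound; easy || lra.
  + rewrite semigroup_zero by lra.
    apply cball_minus_zero.
    apply cball_zero; [easy | apply int_const_Rpower_nonneg].
Qed.

Lemma delayed_ext h u u' t : 0 < h -> (forall x, 0 < x <= t - h -> u x = u' x) ->
  delayed h u t = delayed h u' t.
Proof.
intros Hh H. unfold delayed. destruct (Rlt_dec (2 * h) t) as [Hlt | Hge]; [|easy].
unfold duhamel. f_equal. apply (RInt_ext (V := E (rho t))). intros x.
rewrite Rmin_left, Rmax_right by lra. intros Hx.
unfold integrand. rewrite H; [easy | lra].
Qed.

(** Method of steps: values on (0, t-h] determine the value at t, so the n-th iterate solves the
    equation on (0, nh], and finitely many iterations cover (0, Tstar). *)
Lemma delayed_fixpoint h : 0 < h ->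
  exists u, good u /\ forall t, 0 < t < Tstar -> u t = delayed h u t.
Proof.
intros Hh.
pose (it := fun n => Nat.iter n (delayed h) (fun _ => zero)).
assert (Hgood : forall n, good (it n)).
{ induction n as [|n IH]; [apply zero_good | now apply delayed_good]. }
assert (Hfix : forall n t, 0 < t <= INR n * h -> it n t = delayed h (it n) t).
{ induction n as [|n IH]; intros t Ht; [simpl in Ht; lra|].
  change (it (S n) t) with (delayed h (it n) t).
  apply delayed_ext; [easy|]. intros x Hx. rewrite S_INR in Ht. apply IH. lra. }
destruct (nat_large (Tstar / h)) as [n Hn].
exists (it n). split; [easy|]. intros t Ht. apply Hfix. split; [easy|].
apply (Rmult_lt_compat_r h) in Hn; [|easy].
unfold Rdiv in Hn. rewrite Rmult_assoc, Rinv_l in Hn; lra.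
Qed.

Lemma tends_nested {I : Type} (F : (I -> Prop) -> Prop) {FF : Filter F} s s' y l :
  0 < s <= s' -> tends F E s' y l -> tends F E s y l.
Proof.
intros Hs H eps He. generalize (H eps He). apply filter_imp. intros i.
now apply cball_nested.
Qed.

(** * Compactness of the class and passage to the limit *)

Definition pointwise_limit (w : nat -> R -> V) (u : R -> V) : Prop :=
  forall t s, 0 < t < Tstar -> 0 < s < rho t ->
    mem E s (u t) /\ tends eventually E s (fun n => w n t) (u t).

(** A diagonal extraction gives convergence at rational times and indices. At arbitrary t and s, a
    rational time just before t and a rational index above s, still admissible at that time, give
    the Cauchy property by equicontinuity. *)
Lemma good_compact (w : nat -> R -> V) : (forall n, good (w n)) ->
  exists k u, str_inc k /\ pointwise_limit (fun n => w (k n)) u.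
Proof.
intros Hw.
pose (valid := fun i => 0 < fst (rat_pair i) < Tstar /\
  0 < snd (rat_pair i) < rho (fst (rat_pair i))).
destruct (diagonal_subsequence (fun i k => valid i ->
  exists l, tends eventually E (snd (rat_pair i)) (fun n => w (k n) (fst (rat_pair i))) l))
  as (k & Hk & Hconv).
{ intros i k Hk. destruct (classic (valid i)) as [[H1 H2] | Hi].
  - pose (s' := (snd (rat_pair i) + rho (fst (rat_pair i))) / 2).
    destruct (bounded_extract (snd (rat_pair i)) s' Rad
      (fun n => w (k n) (fst (rat_pair i)))) as (k' & l & Hk' & _ & Hl).
    + unfold s'. lra.
    + intros n. apply good_admissible; [easy | easy | unfold s'; lra].
    + exists k'. split; [easy|]. intros _. now exists l.
  - exists (fun n => n). split; [intros n; lia | easy]. }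
{ intros i k k' [M HM] HQ Hi. destruct (HQ Hi) as [l Hl]. exists l.
  intros eps He. destruct (Hl eps He) as [N HN]. exists (max M N). intros n Hn.
  destruct (HM n ltac:(lia)) as (j & Hj & ->). apply HN. lia. }
assert (Hlim : forall t s, 0 < t < Tstar -> 0 < s < rho t ->
  exists l, mem E s l /\ tends eventually E s (fun n => w (k n) t) l).
{ intros t s Ht Hs. apply scale_complete; [easy | |].
  { intros n. apply cball_mem with Rad. apply good_admissible; easy || lra. }
  intros eps He.
  destruct (rho_index_before t s) as (s' & t1 & Hs' & Ht1 & Hst1); try lra.
  destruct (good_equicontinuous t s (eps / 3) Ht Hs ltac:(lra)) as (d & Hd & Heq).
  destruct (rat_pair_dense (Rmax t1 (t - d)) t s s') as (i & Hi1 & Hi2); try lra.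
  { split; [apply Rle_trans with t1; [lra | apply Rmax_l] | apply Rmax_lub_lt; lra]. }
  set (q := fst (rat_pair i)) in *. set (s1 := snd (rat_pair i)) in *.
  assert (Hq1 := Rle_lt_trans _ _ _ (Rmax_l _ _) (proj1 Hi1)).
  assert (Hq2 := Rle_lt_trans _ _ _ (Rmax_r _ _) (proj1 Hi1)).
  assert (Hrq : rho t1 < rho q) by (apply rho_lt; lra).
  assert (Hval : valid i).
  { unfold valid. fold q s1. lra. }
  destruct (Hconv i Hval) as [l Hl]. fold q s1 in Hl.
  destruct (Hl (eps / 6) ltac:(lra)) as [N HN].
  exists N. intros n m Hn Hm.
  assert (Hqt : forall n, cball E s (eps / 3) (minus (w (k n) q) (w (k n) t))).
  { intros n'. apply Heq; [easy|]. rewrite Rabs_minus_sym, Rabs_pos_eq; lra. }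
  replace eps with (eps / 3 + (eps / 6 + eps / 6 + eps / 3)) by field.
  apply cball_triangle with (w (k n) q); [easy | now apply cball_minus_sym |].
  apply cball_triangle with (w (k m) q); [easy | | easy].
  apply cball_nested with s1; [easy | lra |].
  apply cball_triangle with l; [lra | now apply HN |].
  apply cball_minus_sym; [lra | now apply HN]. }
assert (Hu : forall t, exists l, 0 < t < Tstar -> forall s, 0 < s < rho t ->
  mem E s l /\ tends eventually E s (fun n => w (k n) t) l).
{ intros t. destruct (classic (0 < t < Tstar)) as [Ht | Ht]; [|now exists zero].
  assert (Hr := rho_pos t).
  destruct (Hlim t (rho t / 2) Ht ltac:(lra)) as (l & Hl1 & Hl2).
  exists l. intros _ s Hs. destruct (Hlim t s Ht Hs) as (l' & Hl1' & Hl2').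
  replace l with l'; [easy|].
  (* Limits found at two indices are the same element of [V]: both are limits at the smaller
     index. *)
  assert (Hmin : 0 < Rmin s (rho t / 2)) by (apply Rmin_glb_lt; lra).
  apply (tends_unique E (Rmin s (rho t / 2)) (fun n => w (k n) t)); [easy | |].
  - apply tends_nested with s; [apply eventually_filter | | easy].
    split; [easy | apply Rmin_l].
  - apply tends_nested with (rho t / 2); [apply eventually_filter | | easy].
    split; [easy | apply Rmin_r]. }
apply choice in Hu. destruct Hu as [u Hu].
exists k, u. split; [easy|]. intros t s Ht Hs. now apply Hu.
Qed.

Lemma pointwise_limit_good w u : (forall n, good (w n)) -> pointwise_limit w u -> good u.
Proof.
intros Hw Hu. split.
- intros t s Ht Hs. apply cball_closed; [easy|]. intros eps He.
  destruct (proj2 (Hu t s Ht Hs) eps He) as [N HN].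
  replace (u t) with (minus (w N t) (minus (w N t) (u t))) by module_ring V.
  apply cball_minus; [easy | now apply (proj1 (Hw N)) | now apply HN].
- intros t t' s Ht Ht' Hs. apply cball_closed; [easy|]. intros eps He.
  assert (Hrt : rho t < rho t') by (apply rho_lt; lra).
  destruct (Hu t s ltac:(lra) Hs) as [Hm Hl].
  destruct (Hl (eps / (2 * C))) as [N HN]; [apply Rdiv_lt_0_compat; lra|].
  destruct (proj2 (Hu t' s ltac:(lra) ltac:(lra)) (eps / 2) ltac:(lra)) as [N' HN'].
  pose (n := max N N').
  assert (Hmn : mem E s (w n t)).
  { apply cball_mem with Rad. apply good_admissible; easy || lra. }
  replace (minus (u t') (Sg (t' - t) (u t))) with
    (plus (minus (w n t') (Sg (t' - t) (w n t)))
      (minus (Sg (t' - t) (minus (w n t) (u t))) (minus (w n t') (u t')))).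
  + replace (int_const * Rpower (t' - t) beta + eps) with
      (int_const * Rpower (t' - t) beta + (C * (eps / (2 * C)) + eps / 2)) by (field; lra).
    apply cball_plus; [easy | apply (proj2 (Hw n)); lra |].
    apply cball_minus; [easy | apply semigroup_bounded; [easy | lra |] |].
    * apply HN. unfold n. lia.
    * apply HN'. unfold n. lia.
  + rewrite (semigroup_minus s) by (try apply hEG; easy || lra). module_ring V.
Qed.

(** On [a,b] the singular ends are excluded. Equicontinuity turns pointwise convergence of the
    functions into joint convergence of the integrands near each point, which is then uniform on the
    segment. *)
Lemma duhamel_limit w u t a b : (forall n, good (w n)) -> good u -> pointwise_limit w u ->
  0 < a <= b -> b < t -> t < Tstar ->
  tends eventually E (rho t) (fun n => duhamel (w n) t a b) (duhamel u t a b).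
Proof.
intros Hw Hu Hlim Hab Hb Ht eps He.
assert (Hr := rho_pos t).
assert (Het : 0 < eps / t) by (apply Rdiv_lt_0_compat; lra).
destruct (uniform_on_segment (fun n x =>
  cball E (rho t) (eps / t) (minus (integrand (w n) t x) (integrand u t x))) a b) as [N HN].
{ intros x Hx.
  assert (H1 : tends (filter_prod eventually (locally x)) E (rho t)
    (fun p => integrand (w (fst p)) t (snd p)) (integrand u t x)).
  { apply (integrand_tends (filter_prod eventually (locally x)) snd
      (fun p => w (fst p) (snd p)) t x (u x)); try lra.
    - intros d Hd. exists (fun _ => True) (fun y => Rabs (y - x) < d).
      + now exists 0%nat.
      + apply locally_R. now exists d.
      + easy.
    - apply good_admissible; easy || lra.
    - intros s Hs.
      assert (HE : forall e, 0 < e -> filter_prod eventually (locally x) (fun p =>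
        cball E s Rad (w (fst p) (snd p)) /\ cball E s e (minus (w (fst p) (snd p)) (u x)))).
      { intros e He'.
        destruct (good_equicontinuous x s (e / 2) ltac:(lra) Hs ltac:(lra)) as (d & Hd & Heq).
        exists (fun n => cball E s (e / 2) (minus (w n x) (u x))) (fun y => Rabs (y - x) < d).
        - apply (proj2 (Hlim x s ltac:(lra) Hs)). lra.
        - apply locally_R. now exists d.
        - intros n y Hn Hy. simpl. destruct (Heq (w n) y (Hw n) Hy) as (Hy1 & Hy2 & Hy3).
          split; [apply good_admissible; [easy | easy | lra]|].
          replace e with (e / 2 + e / 2) by field.
          now apply cball_triangle with (w n x). }
      split.
      + generalize (HE 1 Rlt_0_1). apply filter_imp. now intros p [Hp _].
      + intros e He'. generalize (HE e He'). apply filter_imp. now intros p [_ Hp]. }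
  destruct (H1 (eps / t / 2) ltac:(lra)) as [Q P [N HQ] HP HQP].
  apply locally_R in HP. destruct HP as (d1 & Hd1 & HP).
  assert (H2 := good_integrand_tends u t x Hu ltac:(lra) Ht (eps / t / 2) ltac:(lra)).
  apply locally_R in H2. destruct H2 as (d2 & Hd2 & H2).
  exists (Rmin d1 d2), N. split; [now apply Rmin_glb_lt|]. intros n y Hn Hy.
  replace (eps / t) with (eps / t / 2 + eps / t / 2) by (field; lra).
  apply cball_triangle with (integrand u t x); [easy | |].
  - apply (HQP n y); [now apply HQ|]. apply HP. apply Rlt_le_trans with (1 := Hy), Rmin_l.
  - apply cball_minus_sym; [easy|]. apply H2. apply Rlt_le_trans with (1 := Hy), Rmin_r. }
exists N. intros n Hn.
apply cball_le with ((b - a) * (eps / t)).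
- apply (Rmult_le_reg_r t); [lra|]. replace ((b - a) * (eps / t) * t) with ((b - a) * eps)
    by (field; lra). nra.
- apply seg_int_norm_const with (fun x => minus (integrand (w n) t x) (integrand u t x)).
  + easy.
  + intros x Hx. now apply HN.
  + apply seg_int_minus; [easy | |]; apply duhamel_seg_int; easy || lra.
Qed.

(* A quantitative form of the integral equation, avoiding improper integrals. *)
Definition mild (u : R -> V) : Prop :=
  forall t s a b, t < Tstar -> 0 < a <= b -> b < t -> 0 < s < rho t ->
    cball E s (int_const * Rpower a beta + int_const * Rpower (t - b) beta)
      (minus (u t) (duhamel u t a b)).

(** For a delay h below a and t - b, the delayed solution minus its integral over (a,b) consists of
    the pieces over (h,a) and (b,t-h). Their bounds do not involve h and persist in the limit h ->
    0. *)
Lemma mild_solution : exists u, good u /\ mild u.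
Proof.
assert (Hpos : forall n : nat, 0 < / (INR n + 1))
  by (intros n; apply Rinv_0_lt_compat; generalize (pos_INR n); lra).
destruct (choice _ (fun n : nat => delayed_fixpoint (/ (INR n + 1)) (Hpos n))) as [w Hw].
destruct (good_compact w) as (k & u & Hk & Hlim); [intros n; apply Hw|].
assert (Hgood : good u).
{ apply pointwise_limit_good with (2 := Hlim). intros n. apply Hw. }
exists u. split; [easy|]. intros t s a b Ht Hab Hb Hs.
apply cball_closed; [easy|]. intros eps He.
destruct (proj2 (Hlim t s ltac:(lra) Hs) (eps / 2) ltac:(lra)) as [N1 HN1].
destruct (duhamel_limit (fun n => w (k n)) u t a b) with (eps := eps / 2) as [N2 HN2];
  try easy; try lra; [intros n; apply Hw|].
assert (Hc : 0 < Rmin a (t - b)) by (apply Rmin_glb_lt; lra).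
destruct (nat_large (/ Rmin a (t - b))) as [N3 HN3].
pose (n := max N1 (max N2 N3)).
set (h := / (INR (k n) + 1)) in *.
assert (Hh : h < Rmin a (t - b)).
{ rewrite <- (Rinv_inv (Rmin a (t - b))).
  assert (Hci := Rinv_0_lt_compat _ Hc).
  assert (Hle : INR N3 <= INR (k n)).
  { apply le_INR. generalize (str_inc_ge k Hk n). unfold n. lia. }
  apply Rinv_lt_contravar; [apply Rmult_lt_0_compat|]; lra. }
assert (Hh0 : 0 < h) by apply Hpos.
generalize (Rmin_l a (t - b)) (Rmin_r a (t - b)). intros Hm1 Hm2.
destruct (Hw (k n)) as [Hg Hfix].
assert (Hwt : minus (w (k n) t) (duhamel (w (k n)) t a b) =
  plus (duhamel (w (k n)) t h a) (duhamel (w (k n)) t b (t - h))).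
{ rewrite (Hfix t) by lra. unfold delayed. fold h.
  destruct (Rlt_dec (2 * h) t) as [Hlt | Hge]; [|lra].
  rewrite (duhamel_Chasles _ t h a (t - h)), (duhamel_Chasles _ t a b (t - h)) by (easy || lra).
  module_ring V. }
replace (minus (u t) (duhamel u t a b)) with
  (plus (minus (w (k n) t) (duhamel (w (k n)) t a b))
    (minus (minus (duhamel (w (k n)) t a b) (duhamel u t a b)) (minus (w (k n) t) (u t))))
  by module_ring V.
replace eps with (eps / 2 + eps / 2) by field.
apply cball_plus; [easy | rewrite Hwt; apply cball_plus | apply cball_minus]; try easy.
- apply cball_nested with (rho t); [easy | lra |].
  apply cball_le with (int_const * Rpower (a - h) beta); [apply Rpower_mono_scaled; lra|].
  apply duhamel_bound; easy || lra.
- apply cball_nested with (rho t); [easy | lra |].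
  apply cball_le with (int_const * Rpower (t - h - b) beta);
    [apply Rpower_mono_scaled; lra|].
  apply duhamel_bound; easy || lra.
- apply cball_nested with (rho t); [easy | lra |]. apply HN2. unfold n. lia.
- apply HN1. unfold n. lia.
Qed.

(** * Function spaces, initial condition and integral equation *)

Lemma good_mem u t s : good u -> 0 < t < Tstar -> 0 < s < rho t -> mem E s (u t).
Proof. intros Hu Ht Hs. apply cball_mem with Rad. now apply good_admissible. Qed.

Lemma good_in_all_spaces u : good u -> in_all_spaces gamma Tstar E u.
Proof.
intros Hu t Ht s Hs Hst. apply good_mem; [easy | easy |].
split; [easy | apply Rpower_inv_lt; lra].
Qed.

Lemma good_E0space u : good u -> E0space gamma Tstar E u.
Proof.
intros Hu. split; [now apply good_in_all_spaces|].
intros tau s Htau Hs. exists (fun t => lift E s (u t)). intros t Ht.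
assert (Hr : rho tau < rho t) by (apply rho_lt; lra).
assert (Hm : mem E s (u t)) by (apply good_mem; easy || lra).
split; [now apply emb_lift|].
apply tends_lift; [apply locally_filter | easy | easy |].
apply good_locally; easy || lra.
Qed.

Lemma good_in_domain u : good u -> in_domain T Rad gamma Tstar E u.
Proof.
intros Hu t Ht. split; [lra|]. intros s Hs Hst.
apply good_admissible; [easy | easy |]. split; [easy | apply Rpower_inv_lt; lra].
Qed.

Lemma good_zero_initial_condition u : good u -> zero_initial_condition gamma E u.
Proof.
intros Hu c Hc eps. apply at_right_0.
destruct (Rpower_small int_const beta eps) as (d & Hd & H); [lra | apply cond_pos |].
exists (Rmin d Tstar). split; [now apply Rmin_glb_lt|]. intros t Ht.
generalize (Rmin_l d Tstar) (Rmin_r d Tstar) (rho_pos t). intros.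
apply cball_le with (int_const * Rpower t beta); [apply H; lra|].
apply (proj1 Hu); [lra|]. split; [now apply Rmult_lt_0_compat | nra].
Qed.

(** The majorant bounds the norm integral over [x,y] by [int_const] (y-x)^beta, the tail bound of
    the Cauchy criterion. *)
Lemma integrand_norm_integrable u t s : good u -> 0 < t < Tstar -> 0 < s < rho t ->
  ex_RInt_gen (fun xi => norm (lift E s (integrand u t xi))) (at_right 0) (at_left t).
Proof.
intros Hu Ht Hs.
assert (Hb : forall xi, 0 < xi < t -> cball E s
  (integrand_const * (Rpower xi (- chi) + Rpower (t - xi) (- chi))) (integrand u t xi)).
{ intros xi Hxi. apply cball_nested with (rho t); [easy | lra |].
  apply good_integrand_bound; easy || lra. }
apply (ex_RInt_gen_of_tail_bound _ t int_const beta); try lra.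
- intros x Hx. apply (continuous_comp (fun xi => lift E s (integrand u t xi)) norm).
  + apply tends_lift; [apply locally_filter | easy | exact (cball_mem _ _ _ _ (Hb x Hx)) |].
    apply tends_nested with (rho t); [apply locally_filter | lra |].
    apply good_integrand_tends; easy || lra.
  + apply (filterlim_norm (V := E s)).
- intros x y I Hx Hy HI.
  destruct (RInt_Rpower_majorant_le t chi x y) as (J & HJ & HJle); try easy.
  { generalize chi_nonneg. lra. }
  assert (H0 : 0 <= I).
  { apply (is_RInt_le (fun _ => 0) (fun xi => norm (lift E s (integrand u t xi))) x y); try easy.
    - refine (eq_rect _ (is_RInt (fun _ => 0) x y)
        (is_RInt_const (V := R_NormedModule) x y 0) 0 _).
      apply Rmult_0_r.
    - intros xi _. apply norm_ge_0. }
  rewrite Rabs_pos_eq by easy.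
  apply Rle_trans with (integrand_const * J).
  + apply (is_RInt_le (fun xi => norm (lift E s (integrand u t xi)))
      (fun xi => integrand_const * (Rpower xi (- chi) + Rpower (t - xi) (- chi))) x y);
      try easy.
    * exact (is_RInt_scal (V := R_NormedModule) _ _ _ integrand_const _ HJ).
    * intros xi Hxi. apply cball_lift; [easy|]. apply Hb. lra.
  + unfold int_const. rewrite Rmult_assoc. apply Rmult_le_compat_l; [|easy].
    left. apply integrand_const_pos.
Qed.

(** The errors in [mild] vanish as a -> 0 and b -> t, so the truncated integrals converge and their
    limit is u(t). *)
Lemma mild_solves_integral u : good u -> mild u ->
  solves_integral T Rad gamma Tstar E Sg f u.
Proof.
intros Hu Hmild. split; [now apply good_in_domain|].
intros t s Ht Hs Hst. apply Rpower_inv_lt in Hst; try lra.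
assert (Hut : mem E s (u t)) by (apply good_mem; easy || lra).
exists (fun xi => lift E s (integrand u t xi)), (lift E s (u t)).
repeat split.
- intros xi Hxi. apply emb_lift. eapply cball_mem.
  apply cball_nested with (rho t); [easy | lra |]. apply good_integrand_bound; easy || lra.
- apply integrand_norm_integrable; easy || lra.
- intros P [eps HP]. assert (He := cond_pos eps).
  destruct (Rpower_small int_const beta (eps / 4)) as (d0 & Hd0 & H); try lra.
  pose (d := Rmin d0 (t / 2)).
  assert (Hd : 0 < d) by (apply Rmin_glb_lt; lra).
  assert (Hd1 : d <= d0) by apply Rmin_l. assert (Hd2 : d <= t / 2) by apply Rmin_r.
  exists (fun a => 0 < a < d) (fun b => t - d < b < t).
  + apply at_right_0. now exists d.
  + apply at_left_R. now exists d.
  + intros a b Ha Hb. simpl. exists (lift E s (duhamel u t a b)).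
    assert (HD : seg_int E s (integrand u t) a b (duhamel u t a b)).
    { apply seg_int_nested with (rho t); [easy | lra |].
      apply duhamel_seg_int; easy || lra. }
    destruct HD as (_ & _ & HDm & HD). split; [exact HD|].
    apply HP, (@norm_compat1 R_AbsRing (E s)).
    assert (HB : cball E s (eps / 2) (minus (duhamel u t a b) (u t))).
    { apply cball_minus_sym; [easy|].
      apply cball_le with (int_const * Rpower a beta + int_const * Rpower (t - b) beta).
      - generalize (H a ltac:(lra)) (H (t - b) ltac:(lra)). lra.
      - apply Hmild; lra. }
    apply cball_lift in HB; [|easy]. rewrite lift_minus in HB by easy.
    apply Rle_lt_trans with (1 := proj2 HB). lra.
- now apply emb_lift.
Qed.

(** * The differential equation *)

Context (A : V -> V) (hfE : nonlinearity_continuous T Rad E E f) (hA : generator E Sg A).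

Lemma generator_limit s s' v : 0 < s < s' -> mem E s' v -> mem E s (A v) /\
  forall eps, 0 < eps -> exists d, 0 < d /\ forall h, 0 < h < d ->
    cball E s eps (minus (scal (1 / h) (minus (Sg h v) v)) (A v)).
Proof.
intros Hs Hv. replace s' with (s + (s' - s)) in Hv by ring. destruct Hv as [x <-].
destruct (proj2 hA s (s' - s) ltac:(lra) ltac:(lra) x) as [H1 H2].
split; [easy|]. intros eps He. apply at_right_0, (H2 (mkposreal eps He)).
Qed.

Lemma generator_minus s v w : 0 < s -> mem E s v -> mem E s w ->
  A (minus v w) = minus (A v) (A w).
Proof.
intros Hs [x <-] [y <-]. destruct (proj1 hA s Hs) as [HP HS].
replace (minus (emb x) (emb y)) with (plus (emb x) (scal (-1) (emb y))) by module_ring V.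
rewrite <- emb_scal, HP, emb_scal, HS by easy. module_ring V.
Qed.

(** Uniform boundedness of the quotients (S^h - 1)/h. On a fixed vector they are bounded for small h
    because they converge, and for h >= d by (C + 1)/d times the norm. *)
Lemma semigroup_increment s s' : 0 < s < s' -> exists M, 0 <= M /\
  forall h r v, 0 < h <= 1 -> cball E s' r v -> cball E s (h * (M * r)) (minus (Sg h v) v).
Proof.
intros Hs.
pose (q := fun (h : R) (v : V) => scal (1 / h) (minus (Sg h v) v)).
assert (Hq : forall h r v, 0 < h -> cball E s' r v -> cball E s (1 / h * (C * r + r)) (q h v)).
{ intros h r v Hh Hv.
  assert (Hv' : cball E s r v) by (apply cball_nested with s'; easy || lra).
  rewrite <- (Rabs_pos_eq (1 / h)) by (left; apply Rdiv_lt_0_compat; lra).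
  apply cball_scal; [lra|].
  apply cball_minus; [lra | apply semigroup_bounded; easy || lra | easy]. }
assert (Hm : forall h (x : E s'), 0 < h -> mem E s (q h (emb x))).
{ intros h x Hh. eapply cball_mem, (Hq h (norm x)); [easy|]. exists x. split; [easy | lra]. }
assert (Hemb : forall x : E s', mem G s (emb x)).
{ intros x. apply hEG; [lra|].
  destruct (mem_cball E s' (emb x)) as (r & _ & Hr); [now exists x|].
  eapply cball_mem, cball_nested with (3 := Hr); easy || lra. }
destruct (uniform_boundedness (X := E s') (I := {h | 0 < h <= 1})
  (fun h x => norm (lift E s (q (proj1_sig h) (emb x))))) as [M HM].
- intros [h Hh] x y. simpl.
  replace (q h (emb (plus x y))) with (plus (q h (emb x)) (q h (emb y))).
  + rewrite lift_plus by (try apply Hm; lra). apply (norm_triangle (V := E s)).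
  + unfold q. rewrite emb_plus by lra.
    rewrite (semigroup_plus s) by (try apply Hemb; lra). module_ring V.
- intros [h Hh] k x. simpl.
  replace (q h (emb (scal k x))) with (scal k (q h (emb x))).
  + rewrite lift_scal by (try apply Hm; lra). apply (norm_scal (V := E s)).
  + unfold q. rewrite emb_scal by lra.
    rewrite (semigroup_scal s) by (try apply Hemb; lra). module_ring V.
- intros [h Hh]. simpl. exists (1 / h * (C + 1)). intros x. apply cball_lift; [lra|].
  replace (1 / h * (C + 1) * norm x) with (1 / h * (C * norm x + norm x)) by ring.
  apply Hq; [lra|]. exists x. split; [easy | lra].
- intros x.
  destruct (generator_limit s s' (emb x) Hs) as [HAm HAl]; [now exists x|].
  destruct (HAl 1 Rlt_0_1) as (d & Hd & HAd).
  destruct (mem_cball _ _ _ HAm) as (r & Hr & HAr).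
  exists (Rmax (1 + r) (1 / d * (C * norm x + norm x))). intros [h Hh]. simpl.
  apply cball_lift; [lra|].
  destruct (Rlt_le_dec h d) as [Hlt | Hge].
  + apply cball_le with (1 + r); [apply Rmax_l|].
    replace (q h (emb x)) with (plus (minus (q h (emb x)) (A (emb x))) (A (emb x)))
      by module_ring V.
    apply cball_plus; [lra | apply HAd; lra | easy].
  + apply cball_le with (1 / h * (C * norm x + norm x)).
    * apply Rle_trans with (2 := Rmax_r _ _). apply Rmult_le_compat_r.
      -- assert (H0 := norm_ge_0 x). nra.
      -- unfold Rdiv. apply Rmult_le_compat_l; [lra | now apply Rinv_le_contravar].
    * apply Hq; [lra|]. exists x. split; [easy | lra].
- exists (Rabs M). split; [apply Rabs_pos|]. intros h r v Hh (x & <- & Hx).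
  replace (minus (Sg h (emb x)) (emb x)) with (scal h (q h (emb x)))
    by (unfold q; module_ring V; field; lra).
  apply cball_le with (Rabs h * (Rabs M * r)); [rewrite Rabs_pos_eq by lra; lra|].
  apply cball_scal; [lra|].
  apply cball_lift; [lra|]. split; [apply Hm; lra|].
  apply Rle_trans with (1 := HM (exist _ h Hh) x).
  apply Rle_trans with (Rabs M * norm x).
  + apply Rmult_le_compat_r; [apply norm_ge_0 | apply Rle_abs].
  + apply Rmult_le_compat_l; [apply Rabs_pos | easy].
Qed.

Lemma generator_bounded s s' : 0 < s < s' -> exists M, 0 <= M /\
  forall r v, cball E s' r v -> cball E s (M * r) (A v).
Proof.
intros Hs. destruct (semigroup_increment s s' Hs) as (M & HM & H).
exists M. split; [easy|]. intros r v Hv. apply cball_closed; [lra|]. intros eps He.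
destruct (generator_limit s s' v Hs (cball_mem _ _ _ _ Hv)) as [_ HA].
destruct (HA eps He) as (d & Hd & HAd).
pose (h := Rmin d 1 / 2).
assert (Hh : 0 < h < d /\ h <= 1).
{ assert (0 < Rmin d 1) by (apply Rmin_glb_lt; lra).
  generalize (Rmin_l d 1) (Rmin_r d 1). unfold h. lra. }
replace (A v) with (minus (scal (1 / h) (minus (Sg h v) v))
  (minus (scal (1 / h) (minus (Sg h v) v)) (A v))) by module_ring V.
apply cball_minus; [lra | | apply HAd; lra].
replace (M * r) with (Rabs (1 / h) * (h * (M * r))).
- apply cball_scal; [lra|]. apply H; [lra | easy].
- rewrite Rabs_pos_eq by (left; apply Rdiv_lt_0_compat; lra). field. lra.
Qed.

Lemma nonlinearity_continuous_along u t s : good u -> 0 < t < Tstar -> 0 < s < rho t ->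
  mem E s (f t (u t)) /\ tends (locally t) E s (fun r => f r (u r)) (f t (u t)).
Proof.
intros Hu Ht Hs.
destruct (good_locally u t (s + (rho t - s) / 2) Hu Ht ltac:(lra)) as [H1 H2].
apply (nonlinearity_tends (locally t) E (fun r => r) u t (u t) s ((rho t - s) / 2));
  try easy; try lra.
- intros d Hd. apply locally_R. now exists d.
- apply good_admissible; easy || lra.
Qed.

(** u(t2) - S^(t2-t1) u(t1) is the Duhamel integral over (t1,t2), and near t0 its integrand is close
    to f(t0,u(t0)): here f is continuous into E_s, where S^(t-xi) is bounded and close to the
    identity. Both t1 and t2 are free, so t0 may be either end. *)
Lemma duhamel_increment u t0 s eps : good u -> mild u -> 0 < t0 < Tstar -> 0 < s < rho t0 ->
  0 < eps -> exists d, 0 < d /\ forall t1 t2, t0 - d < t1 < t2 -> t2 < t0 + d ->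
    cball E s (eps * (t2 - t1))
      (minus (minus (u t2) (Sg (t2 - t1) (u t1))) (scal (t2 - t1) (f t0 (u t0)))).
Proof.
intros Hu Hmild Ht0 Hs He.
destruct (nonlinearity_continuous_along u t0 s Hu Ht0 Hs) as [Hfm Hft].
assert (HfG : mem G s (f t0 (u t0))) by (apply hEG; easy || lra).
destruct (proj1 (locally_R _ _) (Hft (eps / (4 * C)) ltac:(apply Rdiv_lt_0_compat; lra)))
  as (d1 & Hd1 & H1).
destruct (semigroup_continuous_0 s (f t0 (u t0)) (eps / 4)) as (d2 & Hd2 & H2);
  try easy; try lra.
destruct (rho_index_before t0 s) as (s' & t' & Hs' & Ht' & Hst'); try lra.
pose (d := Rmin (Rmin d1 (d2 / 2)) (Rmin (t0 - t') (Tstar - t0))).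
assert (Hd : 0 < d) by (repeat apply Rmin_glb_lt; lra).
assert (Hdle : d <= d1 /\ d <= d2 / 2 /\ d <= t0 - t' /\ d <= Tstar - t0).
{ generalize (Rmin_l (Rmin d1 (d2 / 2)) (Rmin (t0 - t') (Tstar - t0)))
    (Rmin_r (Rmin d1 (d2 / 2)) (Rmin (t0 - t') (Tstar - t0)))
    (Rmin_l d1 (d2 / 2)) (Rmin_r d1 (d2 / 2))
    (Rmin_l (t0 - t') (Tstar - t0)) (Rmin_r (t0 - t') (Tstar - t0)). fold d. lra. }
assert (Hint : forall t xi, t0 - d < xi < t -> t < t0 + d ->
  cball E s (eps / 2) (minus (integrand u t xi) (f t0 (u t0)))).
{ intros t xi Hxi Ht.
  assert (Hfx : cball E s (eps / (4 * C)) (minus (f xi (u xi)) (f t0 (u t0))))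
    by (apply H1, Rabs_def1; lra).
  replace (eps / 2) with (C * (eps / (4 * C)) + eps / 4) by (field; lra).
  unfold integrand. apply cball_triangle with (Sg (t - xi) (f t0 (u t0))); [easy | |].
  - assert (HfxG : mem G s (f xi (u xi))).
    { apply hEG; [easy|].
      replace (f xi (u xi)) with (plus (minus (f xi (u xi)) (f t0 (u t0))) (f t0 (u t0)))
        by module_ring V.
      apply mem_plus; [easy | exact (cball_mem _ _ _ _ Hfx) | easy]. }
    rewrite <- (semigroup_minus s) by (easy || lra).
    apply semigroup_bounded; easy || lra.
  - apply H2. lra. }
exists d. split; [easy|]. intros t1 t2 Ht12 Ht2.
(* Two end pieces of size [int_const] k^beta at t2, and two at t1 multiplied by [C] under the
   semigroup. *)
destruct (Rpower_small (2 * (1 + C) * int_const) beta (eps / 2 * (t2 - t1)))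
  as (k0 & Hk0 & Hk); [lra | apply Rmult_lt_0_compat; lra |].
pose (k := Rmin k0 (Rmin (t1 / 2) (t1 - (t0 - d))) / 2).
assert (Hkle : 0 < k /\ k < k0 /\ k < t1 / 2 /\ k < t1 - (t0 - d)).
{ assert (0 < Rmin k0 (Rmin (t1 / 2) (t1 - (t0 - d)))) by (repeat apply Rmin_glb_lt; lra).
  generalize (Rmin_l k0 (Rmin (t1 / 2) (t1 - (t0 - d))))
    (Rmin_r k0 (Rmin (t1 / 2) (t1 - (t0 - d))))
    (Rmin_l (t1 / 2) (t1 - (t0 - d))) (Rmin_r (t1 / 2) (t1 - (t0 - d))).
  unfold k. lra. }
specialize (Hk k ltac:(lra)).
assert (Hrt1 : rho t' < rho t1) by (apply rho_lt; lra).
assert (Hrt2 : rho t1 < rho t2) by (apply rho_lt; lra).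
assert (HQ1 := Hmild t1 s k (t1 - k) ltac:(lra) ltac:(lra) ltac:(lra) ltac:(lra)).
assert (HQ2 := Hmild t2 s k (t2 - k) ltac:(lra) ltac:(lra) ltac:(lra) ltac:(lra)).
replace (t1 - (t1 - k)) with k in HQ1 by ring.
replace (t2 - (t2 - k)) with k in HQ2 by ring.
(* The window is moved left by k to keep away from the end t2; its length stays t2 - t1, and k is
   small enough for it to stay near t0. *)
assert (HJ : cball E s ((t2 - t1) * (eps / 2))
  (minus (duhamel u t2 (t1 - k) (t2 - k)) (scal (t2 - t1) (f t0 (u t0))))).
{ replace (t2 - t1) with (t2 - k - (t1 - k)) by ring.
  apply seg_int_norm_const with (fun xi => minus (integrand u t2 xi) (f t0 (u t0))); [easy | |].
  - intros xi Hxi. apply Hint; lra.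
  - apply seg_int_minus; [easy | | apply seg_int_const; easy || lra].
    apply seg_int_nested with (rho t2); [easy | lra | apply duhamel_seg_int; easy || lra]. }
assert (HD1 : mem E s (duhamel u t1 k (t1 - k))).
{ apply cball_mem with (int_const * Rpower (t1 - k - k) beta), cball_nested with (rho t1);
    [easy | lra | apply duhamel_bound; easy || lra]. }
assert (Hu1 : mem E s (u t1)) by (apply good_mem; easy || lra).
replace (minus (minus (u t2) (Sg (t2 - t1) (u t1))) (scal (t2 - t1) (f t0 (u t0)))) with
  (plus (minus (minus (u t2) (duhamel u t2 k (t2 - k)))
           (Sg (t2 - t1) (minus (u t1) (duhamel u t1 k (t1 - k)))))
     (minus (duhamel u t2 (t1 - k) (t2 - k)) (scal (t2 - t1) (f t0 (u t0))))).
- apply cball_le with (int_const * Rpower k beta + int_const * Rpower k beta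
    + C * (int_const * Rpower k beta + int_const * Rpower k beta) + (t2 - t1) * (eps / 2));
    [lra|].
  apply cball_plus; [easy | | easy].
  apply cball_minus; [easy | easy | apply semigroup_bounded; easy || lra].
- rewrite (semigroup_minus s) by (try (apply hEG); easy || lra).
  rewrite duhamel_semigroup by (easy || lra).
  rewrite (duhamel_Chasles u t2 k (t1 - k) (t2 - k)) by (easy || lra).
  module_ring V.
Qed.

(** To the right, the Duhamel increment and the quotient (S^h - 1)u(t0)/h suffice. To the left the
    quotient acts on the moving vector u(t); it is replaced by u(t0) at the cost of (S^h - 1)(u(t) -
    u(t0)), which is o(h) by the uniform bound on the quotients and continuity of u at a slightly
    higher index. *)
Lemma mild_derivative u t0 s eps : good u -> mild u -> 0 < t0 < Tstar -> 0 < s < rho t0 ->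
  0 < eps -> exists d, 0 < d /\ forall t, Rabs (t - t0) < d ->
    cball E s (eps * Rabs (t - t0)) (minus (minus (u t) (u t0))
      (scal (t - t0) (plus (f t0 (u t0)) (A (u t0))))).
Proof.
intros Hu Hmild Ht0 Hs He.
destruct (duhamel_increment u t0 s (eps / 3) Hu Hmild Ht0 Hs ltac:(lra)) as (d1 & Hd1 & H1).
pose (s' := (s + rho t0) / 2).
assert (Hs' : s < s' < rho t0) by (unfold s'; lra).
assert (Hut0 : mem E s' (u t0)) by (apply good_mem; easy || lra).
destruct (generator_limit s s' (u t0) ltac:(lra) Hut0) as [HAm HAl].
destruct (HAl (eps / 3) ltac:(lra)) as (d2 & Hd2 & H2).
destruct (semigroup_increment s s' ltac:(lra)) as (M & HM & HMinc).
destruct (good_equicontinuous t0 s' (eps / 3 / (M + 1)) Ht0 ltac:(lra))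
  as (d3 & Hd3 & H3); [apply Rdiv_lt_0_compat; lra|].
assert (HAinc : forall h, 0 < h < d2 ->
  cball E s (eps / 3 * h) (minus (minus (Sg h (u t0)) (u t0)) (scal h (A (u t0))))).
{ intros h Hh.
  replace (minus (minus (Sg h (u t0)) (u t0)) (scal h (A (u t0)))) with
    (scal h (minus (scal (1 / h) (minus (Sg h (u t0)) (u t0))) (A (u t0))))
    by (module_ring V; field; lra).
  apply cball_le with (Rabs h * (eps / 3)); [rewrite Rabs_pos_eq by lra; lra|].
  apply cball_scal; [easy | now apply H2]. }
exists (Rmin (Rmin d1 d2) (Rmin d3 1)). split; [repeat apply Rmin_glb_lt; lra|].
intros t Ht.
assert (Hd : Rabs (t - t0) < d1 /\ Rabs (t - t0) < d2 /\ Rabs (t - t0) < d3 /\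
  Rabs (t - t0) < 1).
{ generalize (Rmin_l (Rmin d1 d2) (Rmin d3 1)) (Rmin_r (Rmin d1 d2) (Rmin d3 1))
    (Rmin_l d1 d2) (Rmin_r d1 d2) (Rmin_l d3 1) (Rmin_r d3 1). lra. }
destruct Hd as (Hl1 & Hl2 & Hl3 & Hl4).
destruct (H3 u t Hu Hl3) as (Htd & Hst & Hut).
clear Ht. destruct (Rtotal_order t t0) as [Hlt | [-> | Hlt]].
- rewrite Rabs_left in * by lra.
  pose (h := t0 - t).
  assert (HD := H1 t t0 ltac:(lra) ltac:(lra)). fold h in HD.
  assert (HI := HMinc h _ _ ltac:(unfold h; lra) Hut).
  assert (HA' := HAinc h ltac:(unfold h; lra)).
  assert (Hmt : mem G s (u t)) by (apply hEG; [easy | apply good_mem; easy || lra]).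
  assert (Hmt0 : mem G s (u t0)) by (apply hEG; [easy | apply good_mem; easy || lra]).
  apply cball_le with (eps / 3 * h + (h * (M * (eps / 3 / (M + 1))) + eps / 3 * h)).
  + assert (HMle : M * (eps / 3 / (M + 1)) <= eps / 3).
    { apply (Rmult_le_reg_r (M + 1)); [lra|].
      replace (M * (eps / 3 / (M + 1)) * (M + 1)) with (M * (eps / 3)) by (field; lra). nra. }
    replace (- (t - t0)) with h by (unfold h; ring).
    assert (0 < h) by (unfold h; lra). nra.
  + match goal with |- cball _ _ _ ?x => replace x with
      (opp (plus (minus (minus (u t0) (Sg h (u t))) (scal h (f t0 (u t0))))
        (plus (minus (Sg h (minus (u t) (u t0))) (minus (u t) (u t0)))
           (minus (minus (Sg h (u t0)) (u t0)) (scal h (A (u t0))))))) end.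
    * apply cball_opp; [easy|]. apply cball_plus; [easy | easy | now apply cball_plus].
    * rewrite (semigroup_minus s) by (easy || unfold h; lra).
      unfold h. module_ring V.
- match goal with |- cball _ _ _ ?x => replace x with (@zero V) by module_ring V end.
  apply cball_zero; [easy|]. apply Rmult_le_pos; [lra | apply Rabs_pos].
- rewrite Rabs_pos_eq in * by lra.
  assert (HD := H1 t0 t ltac:(lra) ltac:(lra)).
  assert (HA' := HAinc (t - t0) ltac:(lra)).
  apply cball_le with (eps / 3 * (t - t0) + eps / 3 * (t - t0)); [nra|].
  match goal with |- cball _ _ _ ?x => replace x with
    (plus (minus (minus (u t) (Sg (t - t0) (u t0))) (scal (t - t0) (f t0 (u t0))))
      (minus (minus (Sg (t - t0) (u t0)) (u t0)) (scal (t - t0) (A (u t0)))))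
    by module_ring V end.
  now apply cball_plus.
Qed.

(** Continuity of A u at index s follows from that of u at an index between s and rho t, since A is
    bounded between these spaces. *)
Lemma velocity_continuous u t s : good u -> 0 < t < Tstar -> 0 < s < rho t ->
  mem E s (plus (f t (u t)) (A (u t))) /\
  tends (locally t) E s (fun r => plus (f r (u r)) (A (u r))) (plus (f t (u t)) (A (u t))).
Proof.
intros Hu Ht Hs.
destruct (nonlinearity_continuous_along u t s Hu Ht Hs) as [Hm Hf].
pose (s' := (s + rho t) / 2).
assert (Hs' : s < s' < rho t) by (unfold s'; lra).
assert (Hut : mem E s' (u t)) by (apply good_mem; easy || lra).
destruct (generator_limit s s' (u t) ltac:(lra) Hut) as [HAm _].
split; [now apply mem_plus|]. intros eps He.
destruct (generator_bounded s s' ltac:(lra)) as (M & HM & HA).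
assert (He' : 0 < eps / 2 / (M + 1)) by (apply Rdiv_lt_0_compat; lra).
destruct (good_equicontinuous t s' _ Ht ltac:(lra) He') as (d & Hd & H).
assert (Hl : locally t (fun r => Rabs (r - t) < d)) by (apply locally_R; now exists d).
assert (Hl' : locally t (fun r => cball E s (eps / 2) (minus (f r (u r)) (f t (u t)))))
  by (apply Hf; lra).
generalize (filter_and _ _ Hl' Hl). apply filter_imp.
intros r [Hr1 Hr2]. destruct (H u r Hu Hr2) as (Hr3 & Hr4 & Hr5).
replace (minus (plus (f r (u r)) (A (u r))) (plus (f t (u t)) (A (u t)))) with
  (plus (minus (f r (u r)) (f t (u t))) (A (minus (u r) (u t)))).
- replace eps with (eps / 2 + eps / 2) by field. apply cball_plus; [easy | easy |].
  apply cball_le with (M * (eps / 2 / (M + 1))); [|now apply HA].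
  apply (Rmult_le_reg_r (M + 1)); [lra|].
  replace (M * (eps / 2 / (M + 1)) * (M + 1)) with (M * (eps / 2)) by (field; lra). nra.
- rewrite (generator_minus s') by (try (apply good_mem); easy || lra). module_ring V.
Qed.

Lemma mild_is_derive u t s : good u -> mild u -> 0 < t < Tstar -> 0 < s < rho t ->
  is_derive (fun r => lift E s (u r)) t (lift E s (plus (f t (u t)) (A (u t)))).
Proof.
intros Hu Hmild Ht Hs. apply is_derive_norm. intros eps He.
destruct (mild_derivative u t s eps Hu Hmild Ht Hs He) as (d1 & Hd1 & H1).
destruct (good_equicontinuous t s 1 Ht Hs Rlt_0_1) as (d2 & Hd2 & H2).
exists (Rmin d1 d2). split; [now apply Rmin_glb_lt|]. intros r Hr.
assert (HD := H1 r (Rlt_le_trans _ _ _ Hr (Rmin_l _ _))).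
destruct (H2 u r Hu (Rlt_le_trans _ _ _ Hr (Rmin_r _ _))) as (Hr1 & Hr2 & _).
destruct (velocity_continuous u t s Hu Ht Hs) as [Hvm _].
assert (Hmr : mem E s (u r)) by (apply good_mem; easy || lra).
assert (Hmt : mem E s (u t)) by (apply good_mem; easy || lra).
apply cball_lift in HD; [|easy]. destruct HD as [_ HD].
rewrite lift_minus, lift_minus, lift_scal in HD;
  try easy; [now apply mem_minus | now apply mem_scal].
Qed.

Lemma mild_E1space u : good u -> mild u -> E1space gamma Tstar E u.
Proof.
intros Hu Hmild. split; [now apply good_in_all_spaces|].
intros tau s Htau Hs.
exists (fun t => lift E s (u t)), (fun t => lift E s (plus (f t (u t)) (A (u t)))).
intros t Ht.
assert (Hr : rho tau < rho t) by (apply rho_lt; lra).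
split; [apply emb_lift, good_mem; easy || lra|].
split; [apply mild_is_derive; easy || lra|].
destruct (velocity_continuous u t s Hu ltac:(lra) ltac:(lra)) as [Hm Hv].
now apply tends_lift; [apply locally_filter | | |].
Qed.

Lemma mild_solves_ode u : good u -> mild u -> solves_ode T Rad gamma Tstar E f A u.
Proof.
intros Hu Hmild. split; [now apply good_in_domain|].
intros t s Ht Hs Hst. apply Rpower_inv_lt in Hst; try lra.
exists (fun r => lift E s (u r)), (lift E s (plus (f t (u t)) (A (u t)))).
split; [|split].
- destruct (good_equicontinuous t s 1 Ht ltac:(lra) Rlt_0_1) as (d & Hd & H).
  apply locally_R. exists d. split; [easy|]. intros r Hr.
  destruct (H u r Hu Hr) as (Hr1 & Hr2 & _). apply emb_lift, good_mem; easy || lra.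
- apply mild_is_derive; easy || lra.
- apply emb_lift, velocity_continuous; easy || lra.
Qed.

End MildSolutions.

(** * Choice of the existence time and conclusion *)

(** The a priori bound has to stay within the ball of radius [Rad]. Only numbers enter, so the time
    is fixed before any spaces, semigroup or nonlinearity. *)
Lemma existence_time (C T Rad phi alpha gamma : R) :
  0 < T -> 0 < Rad -> phi + alpha / gamma < 1 ->
  exists Tstar, 0 < Tstar <= T /\ forall t, 0 < t < Tstar ->
    int_const C phi alpha gamma * Rpower t (1 - (phi + alpha / gamma)) <= Rad.
Proof.
intros HT HR Hchi.
destruct (Rpower_small (int_const C phi alpha gamma) (1 - (phi + alpha / gamma)) Rad)
  as (d & Hd & H); try lra.
exists (Rmin T d). split; [split; [now apply Rmin_glb_lt | apply Rmin_l]|].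
intros t Ht. apply H. generalize (Rmin_r T d). lra.
Qed.

Theorem theorem1 (C T Rad phi alpha gamma : R)
  (hC : 0 < C) (hT : 0 < T) (hRad : 0 < Rad)
  (hphi : 0 <= phi) (halpha : 0 <= alpha) (hgamma : 1 < gamma)
  (hchi : phi + alpha / gamma < 1) :
  (exists Tstar : R, 0 < Tstar /\
    forall (V : ModuleSpace R_Ring) (E : scale V)
           (Sg : R -> V -> V) (f : R -> V -> V) (A : V -> V),
      compact_embeddings E ->
      norm_monotone E ->
      strongly_continuous_semigroup C E E Sg ->
      parabolic C T phi gamma E E Sg ->
      nonlinearity_continuous T Rad E E f ->
      nonlinearity_bounded C T Rad alpha gamma E E f ->
      generator E Sg A ->
      exists u : R -> V,
        E1space gamma Tstar E u /\
        solves_ode T Rad gamma Tstar E f A u /\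
        zero_initial_condition gamma E u /\
        solves_integral T Rad gamma Tstar E Sg f u)
  /\
  (exists Tstar : R, 0 < Tstar /\
    forall (V : ModuleSpace R_Ring) (E G : scale V)
           (Sg : R -> V -> V) (f : R -> V -> V),
      scale_incl E G ->
      compact_embeddings E ->
      norm_monotone E ->
      strongly_continuous_semigroup C E G Sg ->
      parabolic C T phi gamma E G Sg ->
      nonlinearity_continuous T Rad E G f ->
      nonlinearity_bounded C T Rad alpha gamma E G f ->
      exists u : R -> V,
        E0space gamma Tstar E u /\
        solves_integral T Rad gamma Tstar E Sg f u).
Proof.
destruct (existence_time C T Rad phi alpha gamma hT hRad hchi) as (Tstar & HT & HR).
split; exists Tstar; (split; [easy|]).
- intros V E Sg f A Hcpt Hmon HS Hpar Hfc Hfb HA.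
  (* The classical setup is the case G = E; the continuity of f then serves both as continuity into
     G and as continuity into E. *)
  assert (HEE : scale_incl E E) by (intros s _ v Hv; exact Hv).
  destruct (mild_solution C T Rad phi alpha gamma hC hphi halpha hgamma hchi E E Sg f
    HEE Hcpt Hmon HS Hpar Hfc Hfb Tstar HT HR) as (u & Hgood & Hmild).
  exists u.
  split; [exact (mild_E1space C T Rad phi alpha gamma hC hphi halpha hgamma hchi E E Sg f
    HEE Hcpt Hmon HS Hpar Hfc Hfb Tstar HT HR A Hfc HA u Hgood Hmild)|].
  split; [exact (mild_solves_ode C T Rad phi alpha gamma hC hphi halpha hgamma hchi E E Sg f
    HEE Hcpt Hmon HS Hpar Hfc Hfb Tstar HT HR A Hfc HA u Hgood Hmild)|].
  split; [exact (good_zero_initial_condition C T phi alpha gamma hchi E Sg Tstar HT u Hgood)|].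
  exact (mild_solves_integral C T Rad phi alpha gamma hC hphi halpha hgamma hchi E E Sg f
    HEE Hcpt Hmon HS Hpar Hfc Hfb Tstar HT HR u Hgood Hmild).
- intros V E G Sg f HEG Hcpt Hmon HS Hpar Hfc Hfb.
  destruct (mild_solution C T Rad phi alpha gamma hC hphi halpha hgamma hchi E G Sg f
    HEG Hcpt Hmon HS Hpar Hfc Hfb Tstar HT HR) as (u & Hgood & Hmild).
  exists u.
  split; [exact (good_E0space C T Rad phi alpha gamma hC hgamma hchi E G Sg HEG Hcpt HS
    Tstar HT HR u Hgood)|].
  exact (mild_solves_integral C T Rad phi alpha gamma hC hphi halpha hgamma hchi E G Sg f
    HEG Hcpt Hmon HS Hpar Hfc Hfb Tstar HT HR u Hgood Hmild).
Qed.
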